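(* Let $\mathcal{A}:\mathbb{R}^{m\times n}\to\mathbb{R}^p$ be a linear map with adjoint $\mathcal{A}^*$, let $b\in\mathbb{R}^p$ with $\|\mathcal{A}^*b\|_2>0$, and let $Q=\{z\in\mathbb{R}^p\mid \|\mathcal{A}^*z\|_2\leqslant 1\}$. Then, for some $\gamma>0$, the projection function $\Pi_Q(\cdot)$ is $\gamma$-order semismooth on $\mathbb{R}^p$ and the value function $\varphi(\lambda)=\|\lambda\Pi_Q(\lambda^{-1}b)\|$ is also $\gamma$-order semismooth on $(0,+\infty)$.
   Context: For matrices, $\|\cdot\|_2$ is the spectral norm; for vectors, $\|\cdot\|$ is the Euclidean norm. $\Pi_Q$ is the Euclidean projection onto $Q$. For a locally Lipschitz function $F:\mathcal{O}\subset\mathcal{X}\to\mathcal{Y}$ ($\mathcal{X},\mathcal{Y}$ real Euclidean spaces, $\mathcal{O}$ open), the B-subdifferential $\partial_BF(x)$ is the set of limits of Jacobians $F'(x^k)$ along sequences $x^k\to x$ of differentiability points, and $\partial F(x):=\operatorname{conv}\partial_BF(x)$ is the Clarke generalized Jacobian. For $\gamma>0$, $F$ is $\gamma$-order G-semismooth at $x$ if for any $h\to 0$ and $V\in\partial F(x+h)$, $F(x+h)-F(x)-Vh=O(\|h\|^{1+\gamma})$. $F$ is $\gamma$-order directionally differentiable at $x$ if the directional derivatives $F'(x;h):=\lim_{t\downarrow 0}(F(x+th)-F(x))/t$ exist for all $h$ and, as $h\to0$, $F(x+h)-F(x)-F'(x;h)=O(\|h\|^{1+\gamma})$. $F$ is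 $\gamma$-order semismooth at $x$ if it is both $\gamma$-order G-semismooth and $\gamma$-order directionally differentiable at $x$, and $\gamma$-order semismooth on a set if it is so at each point of the set. *)

(* Defs.v *)
From mathcomp Require Import all_boot all_order all_algebra.
From mathcomp Require Import all_classical all_reals all_analysis.

Set Implicit Arguments.
Unset Strict Implicit.
Unset Printing Implicit Defensive.

Import Order.TTheory GRing.Theory Num.Theory.
Import numFieldNormedType.Exports.

Local Open Scope classical_set_scope.
Local Open Scope ring_scope.

(* Vectors of R^n are row vectors, as for the library Jacobian ['J F x], which
   acts by ['d F x h = h *m 'J F x].  The library norm [`|x|] on matrices is the
   maximum norm, hence the explicit Euclidean structure below; the topology used
   for limits is the library's, which the Euclidean norm also induces. *)

Definition mxdot (R : realType) (m n : nat) (X Y : 'M[R]_(m, n)) : R :=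
  \sum_i \sum_j X i j * Y i j.

Definition enorm (R : realType) (m n : nat) (X : 'M[R]_(m, n)) : R :=
  Num.sqrt (mxdot X X).

Definition spectral_norm (R : realType) (m n : nat) (X : 'M[R]_(m, n)) : R :=
  sup [set enorm (X *m v) | v in [set v : 'cV[R]_n | enorm v <= 1]].

Definition is_adjoint (R : realType) (m n p : nat)
    (A : {linear 'M[R]_(m, n) -> 'rV[R]_p})
    (Astar : {linear 'rV[R]_p -> 'M[R]_(m, n)}) : Prop :=
  forall X z, mxdot (A X) z = mxdot X (Astar z).

(* Meaningful when [Q] is nonempty, closed and convex: the minimizer then
   exists and is unique. *)
Definition eproj (R : realType) (n : nat) (Q : set 'rV[R]_n)
    (x : 'rV[R]_n) : 'rV[R]_n :=
  get [set y | Q y /\ forall z, Q z -> enorm (x - y) <= enorm (x - z)].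

Definition conv_hull (R : realType) (E : lmodType R) (S : set E) : set E :=
  [set v | exists (k : nat) (w : 'I_k -> R) (u : 'I_k -> E),
     [/\ forall i, 0 <= w i, \sum_i w i = 1, forall i, S (u i)
       & v = \sum_i w i *: u i]].

(* A function on an open set O is represented by a total function [F]; the
   notions at a point of O below depend only on [F] near that point. *)

Definition bsubdiff (R : realType) (n q : nat) (F : 'rV[R]_n -> 'rV[R]_q)
    (x : 'rV[R]_n) : set 'M[R]_(n, q) :=
  [set V | exists u : nat -> 'rV[R]_n,
     [/\ forall k, differentiable F (u k),
         u k @[k --> \oo] --> x
       & 'J F (u k) @[k --> \oo] --> V]].

Definition clarke (R : realType) (n q : nat) (F : 'rV[R]_n -> 'rV[R]_q)
    (x : 'rV[R]_n) : set 'M[R]_(n, q) :=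
  conv_hull (bsubdiff F x).

Definition locally_lipschitz (R : realType) (n q : nat)
    (F : 'rV[R]_n -> 'rV[R]_q) (O : set 'rV[R]_n) : Prop :=
  forall x, O x -> exists (L : R) (U : set 'rV[R]_n), nbhs x U /\
    forall y z, U y -> U z -> enorm (F y - F z) <= L * enorm (y - z).

Definition Gsemismooth (R : realType) (n q : nat) (g : R)
    (F : 'rV[R]_n -> 'rV[R]_q) (x : 'rV[R]_n) : Prop :=
  exists C : R, \forall h \near (0 : 'rV[R]_n), forall V, clarke F (x + h) V ->
    enorm (F (x + h) - F x - h *m V) <= C * enorm h `^ (1 + g).

Definition dirquot (R : realType) (n q : nat) (F : 'rV[R]_n -> 'rV[R]_q)
    (x h : 'rV[R]_n) (t : R) : 'rV[R]_q :=
  t^-1 *: (F (x + t *: h) - F x).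

Definition dirderiv (R : realType) (n q : nat) (F : 'rV[R]_n -> 'rV[R]_q)
    (x h : 'rV[R]_n) : 'rV[R]_q :=
  lim (dirquot F x h t @[t --> 0^'+]).

Definition dirdifferentiable (R : realType) (n q : nat) (g : R)
    (F : 'rV[R]_n -> 'rV[R]_q) (x : 'rV[R]_n) : Prop :=
  (forall h, cvg (dirquot F x h t @[t --> 0^'+])) /\
  exists C : R, \forall h \near (0 : 'rV[R]_n),
    enorm (F (x + h) - F x - dirderiv F x h) <= C * enorm h `^ (1 + g).

Definition semismooth_at (R : realType) (n q : nat) (g : R)
    (F : 'rV[R]_n -> 'rV[R]_q) (x : 'rV[R]_n) : Prop :=
  Gsemismooth g F x /\ dirdifferentiable g F x.

(* Semismoothness is only defined for functions that are locally Lipschitz on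
   an open set, so both requirements are part of the predicate. *)
Definition semismooth_on (R : realType) (n q : nat) (g : R)
    (F : 'rV[R]_n -> 'rV[R]_q) (O : set 'rV[R]_n) : Prop :=
  [/\ open O, locally_lipschitz F O & forall x, O x -> semismooth_at g F x].

(* R identified with R^1. *)
Definition rowfun (R : realType) (f : R -> R) (x : 'rV[R]_1) : 'rV[R]_1 :=
  (f (x 0 0))%:M.

Definition semismooth_real_on (R : realType) (g : R) (f : R -> R)
    (I : set R) : Prop :=
  semismooth_on g (rowfun f) [set x : 'rV[R]_1 | I (x 0 0)].

(* Main.v *)
(** The projection and the value function are semialgebraic, and a semialgebraic
locally Lipschitz [f] is semismooth of some positive order that does not depend
on the point. Only points of differentiability matter, since the error
[f (x + h) - f x - h V] is continuous in [(x + h, V)] and affine in [V].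

Qualitatively, suppose that [f y - f x - f' y (y - x)] is not [o(y - x)]. A
semialgebraic selection then gives a curve of bad points [y = x + s u(s)], whose
directions [u] have monotone, hence convergent, coordinates near [0]. The slopes
[(f (x + s u(s)) - f x) / s] also converge, yet differentiability of [f] along the
curve makes them drop by a fixed amount on every interval [s, 2s] with [s] small.

Quantitatively, quantifier elimination describes the graph of the largest relative
error at distance [t] by polynomials in the parameters, [t] and the error; a
nonzero polynomial in two variables forces the error, which tends to [0], to be
[O(t^(1/d))], where [d] bounds the degrees and so is independent of the
parameters. *)
Require Import Defs.
From HB Require Import structures.
From mathcomp Require Import all_boot all_order all_algebra.
From mathcomp Require Import all_classical all_reals all_analysis.
From mathcomp Require Import ordered_qelim.
From mathcomp Require qe_rcf.
From mathcomp Require Import ring lra.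

Set Implicit Arguments.
Unset Strict Implicit.
Unset Printing Implicit Defensive.

Import Order.TTheory GRing.Theory Num.Theory.
Import numFieldNormedType.Exports.

Local Open Scope classical_set_scope.
Local Open Scope ring_scope.

(** * Semialgebraic sets and functions *)

(** The curve of bad points comes from a bare choice principle, so little beyond the monotonicity of
    its coordinates is known about it: it may a priori jump, and its slope cannot simply be
    differentiated in the parameter. The argument therefore works with increments: at each parameter
    the slope is compared with its values at neighbouring parameters, and the jumps of the curve are
    paid for by the growth of a function that has a limit at 0. Monotonicity itself is obtained
    without cell decomposition, from the fact that a real function has only countably many strict
    local extrema.

    Directional derivatives are a separate and milder error: along a bad curve the directions
    converge, so the limit direction and the Lipschitz bound suffice. To make the data first-order
    definable, the supremum, the minimizer and the square roots are rephrased as polynomial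
    inequalities under quantifiers. *)

Section TermEvaluation.
Variable R : comUnitRingType.
Implicit Types (t : GRing.term R) (e : seq R).

(** A general target ring lets the same term be read as a number or as a polynomial, the two being
    related by [teval_rmorph]. Inverses get the junk value 0; the comparison [evalE] is confined to
    terms satisfying [rterm], which contain none. *)
Fixpoint teval (S : comNzRingType) (c : R -> S) (v : nat -> S) t : S :=
  match t with
  | GRing.Var i => v i
  | GRing.Const x => c x
  | GRing.NatConst n => n%:R
  | GRing.Add t1 t2 => teval c v t1 + teval c v t2
  | GRing.Opp t1 => - teval c v t1
  | GRing.NatMul t1 n => teval c v t1 *+ n
  | GRing.Mul t1 t2 => teval c v t1 * teval c v t2
  | GRing.Inv _ => 0
  | GRing.Exp t1 n => teval c v t1 ^+ n
  end.

Lemma teval_rmorph (S S' : comNzRingType) (f : {rmorphism S -> S'})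
    (c : R -> S) (v : nat -> S) t :
  f (teval c v t) = teval (f \o c) (f \o v) t.
Proof.
elim: t => //=.
- by move=> n; rewrite rmorph_nat.
- by move=> t1 <- t2 <-; rewrite rmorphD.
- by move=> t1 <-; rewrite rmorphN.
- by move=> t1 <- n; rewrite rmorphMn.
- by move=> t1 <- t2 <-; rewrite rmorphM.
- by move=> t1 _; rewrite rmorph0.
- by move=> t1 <- n; rewrite rmorphXn.
Qed.

Lemma eq_teval (S : comNzRingType) (c c' : R -> S) (v v' : nat -> S) t :
  c =1 c' -> v =1 v' -> teval c v t = teval c' v' t.
Proof.
move=> hc hv; elim: t => //=.
- by move=> t1 -> t2 ->.
- by move=> t1 ->.
- by move=> t1 -> n.
- by move=> t1 -> t2 ->.
- by move=> t1 -> n.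
Qed.

Lemma evalE e t : GRing.rterm t -> GRing.eval e t = teval id (nth 0 e) t.
Proof.
elim: t => //=.
- by move=> t1 h1 t2 h2 /andP[/h1-> /h2->].
- by move=> t1 h1 /h1->.
- by move=> t1 h1 n /h1->.
- by move=> t1 h1 t2 h2 /andP[/h1-> /h2->].
- by move=> t1 h1 n /h1->.
Qed.

Fixpoint tinst (f : nat -> GRing.term R) t : GRing.term R :=
  match t with
  | GRing.Var i => f i
  | GRing.Const x => GRing.Const x
  | GRing.NatConst n => GRing.NatConst R n
  | GRing.Add t1 t2 => GRing.Add (tinst f t1) (tinst f t2)
  | GRing.Opp t1 => GRing.Opp (tinst f t1)
  | GRing.NatMul t1 n => GRing.NatMul (tinst f t1) n
  | GRing.Mul t1 t2 => GRing.Mul (tinst f t1) (tinst f t2)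
  | GRing.Inv t1 => GRing.Inv (tinst f t1)
  | GRing.Exp t1 n => GRing.Exp (tinst f t1) n
  end.

Lemma rterm_tinst f t :
  (forall i, GRing.rterm (f i)) -> GRing.rterm t -> GRing.rterm (tinst f t).
Proof.
move=> hf; elim: t => //=.
- by move=> t1 h1 t2 h2 /andP[/h1-> /h2->].
- by move=> t1 h1 t2 h2 /andP[/h1-> /h2->].
Qed.

Lemma eval_tinst f e e' t : (forall i, GRing.eval e (f i) = e'`_i) ->
  GRing.eval e (tinst f t) = GRing.eval e' t.
Proof.
move=> hf; elim: t => //=.
- by move=> t1 -> t2 ->.
- by move=> t1 ->.
- by move=> t1 -> n.
- by move=> t1 -> t2 ->.
- by move=> t1 ->.
- by move=> t1 -> n.
Qed.

End TermEvaluation.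

HB.instance Definition _ (T : eqType) :=
  hasDecEq.Build (GRing.term T) (@ord.term_eqP T).

(** * Closure of semialgebraic predicates and functions under first-order operations *)

Section Semialgebraic.
Variable R : realType.
Implicit Types (t : GRing.term R) (ts : seq (GRing.term R)) (e : seq R).
Implicit Types (P Q : seq R -> Prop).

(** Semialgebraicity is phrased semantically: membership depends only on the signs of finitely many
    polynomials. Boolean operations then just concatenate lists, and formulas are needed only to
    treat a quantifier. *)
Definition same_signs ts e e' :=
  forall t, t \in ts -> Num.sg (GRing.eval e t) = Num.sg (GRing.eval e' t).

(* Environments list the values of the variables, missing ones being [0]; quantifying
   over a variable prepends its value, so that the outer environment becomes
   [drop 1 e] in the body. *)
Definition semialg P := exists ts, all (@GRing.rterm R) ts /\
  forall e e', same_signs ts e e' -> P e -> P e'.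

Lemma same_signs_sym ts e e' : same_signs ts e e' -> same_signs ts e' e.
Proof. by move=> h t /h ->. Qed.

Lemma same_signs_cat ts ts' e e' : same_signs (ts ++ ts') e e' ->
  same_signs ts e e' /\ same_signs ts' e e'.
Proof. by move=> h; split=> t ht; apply: h; rewrite mem_cat ht ?orbT. Qed.

Lemma semialg_iff P Q : (forall e, P e <-> Q e) -> semialg P -> semialg Q.
Proof.
move=> PQ [ts [rts h]]; exists ts; split=> // e e' ee' /PQ Pe.
by apply/PQ; apply: h Pe.
Qed.

Lemma semialg_const (P : Prop) : semialg (fun=> P).
Proof. by exists [::]. Qed.

Lemma semialg_not P : semialg P -> semialg (fun e => ~ P e).
Proof.
move=> [ts [rts h]]; exists ts; split=> // e e' ee' nPe Pe'.
by apply: nPe; apply: h Pe'; apply: same_signs_sym.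
Qed.

Lemma semialg_and P Q :
  semialg P -> semialg Q -> semialg (fun e => P e /\ Q e).
Proof.
move=> [ts [rts h]] [ts' [rts' h']]; exists (ts ++ ts').
rewrite all_cat rts rts'; split=> // e e' /same_signs_cat[ee' ee'2] [Pe Qe].
by split; [apply: h Pe | apply: h' Qe].
Qed.

Lemma semialg_or P Q :
  semialg P -> semialg Q -> semialg (fun e => P e \/ Q e).
Proof.
move=> sP sQ.
apply: semialg_iff (semialg_not (semialg_and (semialg_not sP) (semialg_not sQ))).
by move=> e; split=> [|]; case: (pselect (P e)); case: (pselect (Q e)); tauto.
Qed.

Lemma semialg_imp P Q :
  semialg P -> semialg Q -> semialg (fun e => P e -> Q e).
Proof.
move=> sP sQ; apply: semialg_iff (semialg_or (semialg_not sP) sQ).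
by move=> e; case: (pselect (P e)); case: (pselect (Q e)); tauto.
Qed.

Fixpoint sign_lists (n : nat) : seq (seq R) :=
  if n is m.+1 then [seq x :: s | x <- [:: -1; 0; 1], s <- sign_lists m]
  else [:: [::]].

Lemma sign_listsP ts e :
  [seq Num.sg (GRing.eval e t) | t <- ts] \in sign_lists (size ts).
Proof.
elim: ts => [//|t ts ih]; apply/allpairsP.
exists (Num.sg (GRing.eval e t), [seq Num.sg (GRing.eval e u) | u <- ts]).
split=> //=; rewrite !inE.
by case: sgrP => _; rewrite eqxx ?orbT.
Qed.

Definition sign_atom t (s : R) : ord.formula R :=
  if s == 0 then ord.Equal t (GRing.NatConst R 0)
  else if s == 1 then ord.Lt (GRing.NatConst R 0) t
  else ord.Lt t (GRing.NatConst R 0).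

Definition sign_formula ts (s : seq R) : ord.formula R :=
  foldr (@ord.And R) (@ord.Bool R true)
    [seq sign_atom p.1 p.2 | p <- zip ts s].

Lemma rformula_sign_formula ts s : all (@GRing.rterm R) ts ->
  ord.rformula (sign_formula ts s).
Proof.
elim: ts s => [|t ts ih] [|x s] //= /andP[rt rts].
rewrite -/(sign_formula ts s) ih // andbT /sign_atom.
by case: ifP => _; [|case: ifP => _] => /=; rewrite rt.
Qed.

Lemma holds_sign_formula ts s e : s \in sign_lists (size ts) ->
  ord.holds e (sign_formula ts s) <->
  [seq Num.sg (GRing.eval e t) | t <- ts] = s.
Proof.
elim: ts s => [|t ts ih] s; first by rewrite inE => /eqP->.
case/allpairsP=> -[x s'] [/= hx hs ->] {s}.
rewrite /sign_formula /= -/(sign_formula ts s').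
have hat : ord.holds e (sign_atom t x) <->
    Num.sg (GRing.eval e t) = x.
  move: hx; rewrite !inE /sign_atom => /or3P[] /eqP->.
  - rewrite oppr_eq0 oner_eq0 eq_sym -subr_eq0 opprK (_ : _ == 0 = false) /=; last first.
      by apply/negbTE; rewrite -[1 + 1]/(2%:R) pnatr_eq0.
    by rewrite -sgr_cp0; split=> [/eqP//|->]; rewrite eqxx.
  - by rewrite eqxx /=; split=> [->|]; [rewrite sgr0|move/eqP; rewrite sgr_eq0 => /eqP].
  - rewrite oner_eq0 eqxx /=.
    by rewrite -sgr_cp0; split=> [/eqP//|->]; rewrite eqxx.
split=> [[/hat -> /(ih _ hs) ->]//|[/hat ? /(ih _ hs) ?]]; split=> //.
Qed.

Fixpoint atoms (f : ord.formula R) : seq (GRing.term R) :=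
  match f with
  | ord.Equal t1 t2 | ord.Lt t1 t2
  | ord.Le t1 t2 => [:: GRing.Add t1 (GRing.Opp t2)]
  | ord.And f1 f2 | ord.Or f1 f2
  | ord.Implies f1 f2 => atoms f1 ++ atoms f2
  | ord.Not f1 => atoms f1
  | _ => [::]
  end.

Lemma rterm_atoms f : ord.rformula f ->
  all (@GRing.rterm R) (atoms f).
Proof.
elim: f => //=; do ?[by move=> t1 t2; rewrite andbT];
  by move=> f1 h1 f2 h2 /andP[/h1 ? /h2 ?]; rewrite all_cat; apply/andP.
Qed.

Lemma qf_eval_atoms f e e' : ord.rformula f ->
  same_signs (atoms f) e e' ->
  ord.qf_eval e f = ord.qf_eval e' f.
Proof.
elim: f => //=.
- move=> t1 t2 _ /(_ _ (mem_head _ _)) /= h.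
  by rewrite -subr_eq0 -sgr_eq0 h sgr_eq0 subr_eq0.
- move=> t1 t2 _ /(_ _ (mem_head _ _)) /= h.
  by rewrite -subr_lt0 -sgr_lt0 h sgr_lt0 subr_lt0.
- move=> t1 t2 _ /(_ _ (mem_head _ _)) /= h.
  by rewrite -subr_le0 -sgr_le0 h sgr_le0 subr_le0.
- by move=> f1 h1 f2 h2 /andP[/h1{}h1 /h2{}h2] /same_signs_cat[/h1-> /h2->].
- by move=> f1 h1 f2 h2 /andP[/h1{}h1 /h2{}h2] /same_signs_cat[/h1-> /h2->].
- by move=> f1 h1 f2 h2 /andP[/h1{}h1 /h2{}h2] /same_signs_cat[/h1-> /h2->].
- by move=> f1 h1 /h1{}h1 /h1->.
Qed.

(** Quantifier elimination over real closed fields gives an equivalent quantifier-free formula,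
    whose truth depends only on the signs of the differences between the two sides of its atoms. *)
Lemma holds_semialg (f : ord.formula R) :
  ord.rformula f ->
  exists ts, all (@GRing.rterm R) ts /\ forall e e', same_signs ts e e' ->
    ord.holds e f -> ord.holds e' f.
Proof.
move=> rf.
pose g := ord.quantifier_elim (fun n s => qe_rcf.qfr_to_formula (qe_rcf.wproj n s)) f.
have hg e : reflect (ord.holds e f) (ord.qf_eval e g).
  apply: ord.quantifier_elim_rformP rf.
    exact: qe_rcf.wf_QE_wproj.
  exact: qe_rcf.valid_QE_wproj.
have /andP[_ rg] : ord.qf_form g && ord.rformula g.
  by apply: ord.quantifier_elim_wf rf; exact: qe_rcf.wf_QE_wproj.
exists (atoms g); split; first exact: rterm_atoms.
by move=> e e' ee' /hg; rewrite (qf_eval_atoms rg ee') => /hg.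
Qed.

(** For each of the finitely many sign vectors [s], the formula stating that some [x] realizes [s]
    is decided by finitely many signs at [e]; all of these are collected. If [e'] agrees with [e] on
    them, the sign vector of a witness over [e] is also realized over [e'], and it decides [P]. *)
Lemma semialg_ex (P : R -> seq R -> Prop) :
  semialg (fun e => P e`_0 (drop 1 e)) -> semialg (fun e => exists x, P x e).
Proof.
case=> ts [rts h].
pose f s := ord.Exists 0 (sign_formula ts s).
have /choice[g hg] : forall s, exists us, all (@GRing.rterm R) us /\
    forall e e', same_signs us e e' ->
    ord.holds e (f s) -> ord.holds e' (f s).
  by move=> s; apply: holds_semialg; exact: rformula_sign_formula.
(* Variable 0 is bound in [f s], so its value is immaterial and set to 0; the other variables move
   down by one, so that the terms can be read in [e] instead of [0 :: e]. *)
pose low i : GRing.term R := if i is j.+1 then GRing.Var R j else GRing.NatConst R 0.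
have hlow e i : GRing.eval e (low i) = (0 :: e)`_i by case: i.
exists [seq tinst low t | t <- flatten [seq g s | s <- sign_lists (size ts)]]; split.
  apply/allP => _ /mapP[t /flattenP[us /mapP[s _ ->] ht] ->].
  apply: rterm_tinst; first by case.
  by have [/allP/(_ _ ht)] := hg s.
move=> e e' ee' [x Px].
pose s := [seq Num.sg (GRing.eval (x :: e) t) | t <- ts].
have hs : s \in sign_lists (size ts) by exact: sign_listsP.
have : ord.holds (0 :: e) (f s).
  by exists x; apply/holds_sign_formula.
move/(proj2 (hg s) _ (0 :: e')) => [|x' /(proj1 (holds_sign_formula _ hs)) /= hx'].
  move=> t ht; rewrite -!(eval_tinst _ (hlow _)); apply: ee'.
  by apply: map_f; apply/flattenP; exists (g s) => //; apply: map_f.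
exists x'; have := h (x :: e) (x' :: e'); rewrite /= !drop0; apply=> // t ht.
by apply/esym; move/eq_in_map : hx' => /(_ _ ht).
Qed.

Lemma semialg_all (P : R -> seq R -> Prop) :
  semialg (fun e => P e`_0 (drop 1 e)) -> semialg (fun e => forall x, P x e).
Proof.
move=> sP; have := semialg_not (semialg_ex (P := fun x e => ~ P x e) (semialg_not sP)).
apply: semialg_iff => e; split=> [h x|h [x]]; last by apply.
by apply: contrapT => nP; apply: h; exists x.
Qed.

Lemma semialg_exn n (P : seq R -> seq R -> Prop) :
  semialg (fun e => P (mkseq (nth 0 e) n) (drop n e)) ->
  semialg (fun e => exists s, size s = n /\ P s e).
Proof.
elim: n P => [|n ih] P sP.
  apply: semialg_iff sP => e; rewrite drop0.
  split=> [|[s [/size0nil ->]]//]; by exists [::].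
have /(semialg_ex (P := fun x e => exists s, size s = n /\ P (rcons s x) e)) :
    semialg (fun e =>
    exists s, size s = n /\ P (rcons s e`_0) (drop 1 e)).
  apply: (ih (fun s e => P (rcons s e`_0) (drop 1 e))).
  apply: semialg_iff sP => e.
  by rewrite drop_drop add1n nth_drop addn0 mkseqS.
apply: (@semialg_iff (fun e => exists x s, size s = n /\ P (rcons s x) e)) => e.
split=> [[x [s [hs Ps]]]|[s [hs Ps]]].
  by exists (rcons s x); rewrite size_rcons hs.
case/lastP: s hs Ps => // s x; rewrite size_rcons => -[hs] Ps.
by exists x, s.
Qed.

Lemma row_of_seq n (v : 'rV[R]_n) : exists2 l : seq R, size l = n &
  \row_(i < n) l`_i = v.
Proof.
exists (mkseq (fun i => if insub i is Some j then v 0 j else 0) n).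
  by rewrite size_mkseq.
by apply/rowP => i; rewrite !mxE nth_mkseq // valK.
Qed.

Lemma semialg_exv n (P : 'rV[R]_n -> seq R -> Prop) :
  semialg (fun e => P (\row_(i < n) e`_i) (drop n e)) ->
  semialg (fun e => exists v, P v e).
Proof.
move=> sP; have h := @semialg_exn n (fun s e => P (\row_(i < n) s`_i) e).
apply: (semialg_iff _ (h _)) => [e|].
  split=> [[s [_ Ps]]|[v]]; first by exists (\row_i s`_i).
  by have [s ss <-] := row_of_seq v; exists s.
apply: semialg_iff sP => e.
suff -> : \row_(i < n) e`_i = \row_(i < n) (mkseq (nth 0 e) n)`_i by [].
by apply/rowP => i; rewrite !mxE nth_mkseq.
Qed.

Lemma semialg_allv n (P : 'rV[R]_n -> seq R -> Prop) :
  semialg (fun e => P (\row_(i < n) e`_i) (drop n e)) ->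
  semialg (fun e => forall v, P v e).
Proof.
move=> sP; have := semialg_not (semialg_exv (P := fun v e => ~ P v e) (semialg_not sP)).
apply: semialg_iff => e; split=> [h v|h [v]]; last by apply.
by apply: contrapT => nP; apply: h; exists v.
Qed.

Lemma semialg_allI (I : finType) (P : I -> seq R -> Prop) :
  (forall i, semialg (P i)) -> semialg (fun e => forall i, P i e).
Proof.
move=> sP.
suff h (s : seq I) : semialg (fun e => forall i, i \in s -> P i e).
  apply: semialg_iff (h (enum I)) => e; split=> hP i; last by [].
  by apply: hP; rewrite mem_enum.
elim: s => [|i s ih]; first by apply: semialg_iff (semialg_const True) => e.
apply: semialg_iff (semialg_and (sP i) ih) => e; split=> [[Pi Ps] j|h].
  by rewrite inE => /predU1P[->//|/Ps].
by split=> [|j js]; apply: h; rewrite inE ?eqxx ?js ?orbT.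
Qed.

Lemma semialg_term_eq t1 t2 : GRing.rterm t1 -> GRing.rterm t2 ->
  semialg (fun e => GRing.eval e t1 = GRing.eval e t2).
Proof.
move=> r1 r2; exists [:: GRing.Add t1 (GRing.Opp t2)]; rewrite /= r1 r2.
split=> // e e' /(_ _ (mem_head _ _)) /= h /eqP.
by rewrite -subr_eq0 -sgr_eq0 h sgr_eq0 subr_eq0 => /eqP.
Qed.

Lemma semialg_term_le t1 t2 : GRing.rterm t1 -> GRing.rterm t2 ->
  semialg (fun e => GRing.eval e t1 <= GRing.eval e t2).
Proof.
move=> r1 r2; exists [:: GRing.Add t1 (GRing.Opp t2)]; rewrite /= r1 r2.
split=> // e e' /(_ _ (mem_head _ _)) /= h.
by rewrite -subr_le0 -sgr_le0 h sgr_le0 subr_le0.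
Qed.

Lemma semialg_subst P (tau : nat -> GRing.term R) (s : seq R -> seq R) :
  (forall i, GRing.rterm (tau i)) ->
  (forall e i, GRing.eval e (tau i) = (s e)`_i) ->
  semialg P -> semialg (fun e => P (s e)).
Proof.
move=> rtau htau [ts [rts h]]; exists [seq tinst tau t | t <- ts]; split.
  apply/allP => _ /mapP[t ht ->]; apply: rterm_tinst => //.
  exact: (allP rts).
move=> e e' ee'; apply: h => t ht.
rewrite -!(eval_tinst _ (htau _)); apply: ee'; exact: map_f.
Qed.

Lemma semialg_shift (k j : nat) P : semialg P ->
  semialg (fun e => P (mkseq (nth 0 e) k ++ drop j e)).
Proof.
pose tau i := if (i < k)%N then GRing.Var R i else GRing.Var R (j + (i - k))%N.
apply: (@semialg_subst _ tau).
  by move=> i; rewrite /tau; case: ifP.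
move=> e i; rewrite /tau nth_cat size_mkseq; case: ifP => ik /=.
  by rewrite nth_mkseq.
by rewrite nth_drop.
Qed.

(** A function is semialgebraic when its graph is; the value comes first in the environment, where a
    quantifier can bind it. *)
Definition sfun (g : seq R -> R) := semialg (fun e => g (drop 1 e) = e`_0).

Lemma sfun_ext g h : g =1 h -> sfun g -> sfun h.
Proof. by move=> gh; apply: semialg_iff => e; rewrite gh. Qed.

Lemma sfun_drop k g : sfun g -> sfun (fun e => g (drop k e)).
Proof.
move/(semialg_shift 1 k.+1); apply: semialg_iff => e.
by rewrite /= drop0 drop_drop addn1.
Qed.

(** Substituting [g] amounts to quantifying over its value [x], subject to [g e = x]. *)
Lemma sfun_elim (Q : R -> seq R -> Prop) g : sfun g ->
  semialg (fun e => Q e`_0 (drop 1 e)) -> semialg (fun e => Q (g e) e).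
Proof.
move=> sg sQ; have := semialg_ex (P := fun x e => g e = x /\ Q x e) (semialg_and sg sQ).
by apply: semialg_iff => e; split=> [[x [<-]]//|]; exists (g e).
Qed.

Lemma sfun_term t : GRing.rterm t -> sfun (fun e => GRing.eval e t).
Proof.
move=> rt; apply: (@semialg_iff (fun e => GRing.eval e
    (tinst (fun i => GRing.Var R i.+1) t) = GRing.eval e (GRing.Var R 0))).
  by move=> e; rewrite (@eval_tinst _ _ _ (drop 1 e)) // => i; rewrite nth_drop.
by apply: semialg_term_eq => //; apply: rterm_tinst.
Qed.

Lemma sfun_var i : sfun (fun e => e`_i).
Proof. exact: (@sfun_term (GRing.Var R i)). Qed.

Lemma sfun_const c : sfun (fun=> c).
Proof. exact: (@sfun_term (GRing.Const c)). Qed.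

Lemma semialg_rel2 (r : R -> R -> Prop) g h :
  semialg (fun e => r e`_1 e`_0) -> sfun g -> sfun h ->
  semialg (fun e => r (g e) (h e)).
Proof.
move=> sr sg sh; apply: (sfun_elim (Q := fun x e => r x (h e)) sg).
apply: (sfun_elim (Q := fun y e => r e`_0 y) (sfun_drop 1 sh)).
by apply: semialg_iff sr => e; rewrite nth_drop.
Qed.

Lemma semialg_eq g h : sfun g -> sfun h -> semialg (fun e => g e = h e).
Proof. 
apply: (semialg_rel2 (r := eq)).
exact: (@semialg_term_eq (GRing.Var R 1) (GRing.Var R 0)).
 Qed.

Lemma semialg_le g h : sfun g -> sfun h -> semialg (fun e => g e <= h e).
Proof. 
apply: (semialg_rel2 (r := fun x y => x <= y)).
exact: (@semialg_term_le (GRing.Var R 1) (GRing.Var R 0)).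
 Qed.

Lemma semialg_lt g h : sfun g -> sfun h -> semialg (fun e => g e < h e).
Proof.
move=> sg sh; apply: semialg_iff (semialg_not (semialg_le sh sg)) => e.
by rewrite real_ltNge ?num_real //; split=> /negP.
Qed.

Lemma sfun_op2 (op : R -> R -> R) g h :
  semialg (fun e => op e`_1 e`_0 = e`_2) -> sfun g -> sfun h ->
  sfun (fun e => op (g e) (h e)).
Proof.
move=> so /(sfun_drop 1) sg /(sfun_drop 1) sh.
apply: (sfun_elim (Q := fun x e => op x (h (drop 1 e)) = e`_0) sg).
apply: (sfun_elim (Q := fun y e => op e`_0 y = (drop 1 e)`_0) (sfun_drop 1 sh)).
by apply: semialg_iff so => e; rewrite !nth_drop.
Qed.

Lemma sfun_add g h : sfun g -> sfun h -> sfun (fun e => g e + h e).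
Proof.
apply: (sfun_op2 (op := +%R)); exact: (@semialg_term_eq
  (GRing.Add (GRing.Var R 1) (GRing.Var R 0)) (GRing.Var R 2)).
Qed.

Lemma sfun_mul g h : sfun g -> sfun h -> sfun (fun e => g e * h e).
Proof.
apply: (sfun_op2 (op := *%R)); exact: (@semialg_term_eq
  (GRing.Mul (GRing.Var R 1) (GRing.Var R 0)) (GRing.Var R 2)).
Qed.

Lemma sfun_opp g : sfun g -> sfun (fun e => - g e).
Proof.
by move/(sfun_mul (sfun_const (-1))); apply: sfun_ext => e; rewrite mulN1r.
Qed.

Lemma sfun_abs g : sfun g -> sfun (fun e => `|g e|).
Proof.
move=> /(sfun_drop 1) sg.
apply: (semialg_iff (P := fun e => (0 <= g (drop 1 e) -> g (drop 1 e) = e`_0) /\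
   (g (drop 1 e) <= 0 -> - g (drop 1 e) = e`_0))); last first.
  have s0 := sfun_const 0; have sv := sfun_var 0.
  by apply: semialg_and; apply: semialg_imp;
     [apply: semialg_le|apply: semialg_eq|apply: semialg_le|apply: semialg_eq;
      first apply: sfun_opp].
move=> e; case: (ger0P (g (drop 1 e))) => [h|h]; first split=> [[/(_ isT)]//|he].
  split=> // h'; have g0 : g (drop 1 e) = 0 by apply/le_anti/andP.
  by rewrite -he g0 oppr0.
by rewrite ltW //; split=> [[_ /(_ isT)]//|he].
Qed.

Lemma sfun_inv g : sfun g -> sfun (fun e => (g e)^-1).
Proof.
move=> /(sfun_drop 1) sg.
apply: (semialg_iff (P := fun e => (g (drop 1 e) = 0 -> 0 = e`_0) /\
   (g (drop 1 e) = 0 \/ e`_0 * g (drop 1 e) = 1))); last first.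
  have s0 := sfun_const 0; have s1 := sfun_const 1; have sv := sfun_var 0.
  apply: semialg_and; first by apply: semialg_imp; apply: semialg_eq.
  by apply: semialg_or; apply: semialg_eq => //; apply: sfun_mul.
move=> e; have [->|g0] := eqVneq (g (drop 1 e)) 0.
  by rewrite invr0; split=> [[h _]|<-]; [apply: h|split=> //; left].
split=> [[_ [/eqP|h]]|<-]; first by rewrite (negbTE g0).
  by rewrite -[LHS]mul1r -h mulfK.
by split=> [/eqP|]; rewrite ?(negbTE g0) //; right; rewrite mulVf.
Qed.

Lemma sfun_sum (I : finType) (G : I -> seq R -> R) :
  (forall i, sfun (G i)) -> sfun (fun e => \sum_i G i e).
Proof.
move=> sG; rewrite (_ : (fun _ => _) = \sum_i G i); last first.
  by apply/funext => e; rewrite fct_sumE.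
elim/big_ind: _ => // [|g h sg sh]; first exact: sfun_const.
exact: (sfun_add sg sh).
Qed.

(** Stability under composition, rather than a condition on the graph, is the form in which nested
    expressions are handled syntactically; [semialg_funP] recovers it from the graph. *)
Definition semialg_fun n (f : 'rV[R]_n -> R) := forall v : seq R -> 'rV[R]_n,
  (forall i, sfun (fun e => v e 0 i)) -> sfun (fun e => f (v e)).

Lemma semialg_funP n (f : 'rV[R]_n -> R) :
  semialg (fun e => f (\row_(i < n) e`_i) = e`_n) -> semialg_fun f.
Proof.
move=> sf v sv; have : semialg (fun e => exists w : 'rV[R]_n,
    (forall i, w 0 i = v (drop 1 e) 0 i) /\ f w = e`_0).
  apply: semialg_exv; apply: semialg_and; last first.
    by apply: semialg_iff sf => e; rewrite nth_drop addn0.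
  apply: semialg_allI => i; apply: semialg_eq.
    by apply: (sfun_ext _ (sfun_var i)) => e; rewrite mxE.
  exact: (sfun_drop n (sfun_drop 1 (sv i))).
apply: semialg_iff => e; split=> [[w [hw <-]]|<-]; last by exists (v (drop 1 e)).
by congr f; apply/rowP => i; rewrite hw.
Qed.

End Semialgebraic.

(** * Germs at [0+] and Lojasiewicz exponents *)

Section PolynomialGerms.
Variable R : realType.
Implicit Types (p q b : {poly R}) (B : {poly {poly R}}).

Lemma poly_split (S : idomainType) (p : {poly S}) :
  exists q : {poly S}, p = p.[0]%:P + 'X * q.
Proof.
have : root (p - p.[0]%:P) 0 by rewrite /root !hornerE subrr.
case/factor_theorem => q hq; exists q.
by rewrite subr0 in hq; rewrite mulrC -hq addrC subrK.
Qed.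

Lemma poly_valuation (S : idomainType) (p : {poly S}) : p != 0 ->
  exists k (q : {poly S}), q.[0] != 0 /\ p = q * 'X^k.
Proof.
move=> p0; have [k [q]] := multiplicity_XsubC p 0.
rewrite p0 /= => rq ->; exists k, q; split=> //.
by rewrite subr0.
Qed.

Lemma poly_bound p : exists K, 0 <= K /\
  forall s, 0 <= s <= 1 -> `|p.[s]| <= K.
Proof.
exists (\sum_(i < size p) `|p`_i|); split; first exact: sumr_ge0.
move=> s /andP[s0 s1]; rewrite horner_coef.
apply: le_trans (ler_norm_sum _ _ _) _; apply: ler_sum => i _.
rewrite normrM ler_piMr // normrX ger0_norm //.
exact: exprn_ile1.
Qed.

Lemma bipoly_bound B : exists K, 0 <= K /\
  forall t s, 0 <= t <= 1 -> 0 <= s <= 1 -> `|B.[t%:P].[s]| <= K.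
Proof.
have /choice[K hK] : forall i : nat, exists K, 0 <= K /\
    forall s, 0 <= s <= 1 -> `|(B`_i).[s]| <= K by move=> i; apply: poly_bound.
exists (\sum_(i < size B) K i); split; first by apply: sumr_ge0 => i _; case: (hK i).
move=> t s /andP[t0 t1] s01; rewrite (horner_coef B) horner_sum.
apply: le_trans (ler_norm_sum _ _ _) _; apply: ler_sum => i _.
rewrite hornerM -polyC_exp hornerC normrM normrX (ger0_norm t0).
apply: le_trans (ler_piMr _ _) _; [by [] | exact: exprn_ile1 |].
by case: (hK i) => _; apply.
Qed.

(** The lowest nonzero coefficient decides the sign: after a power of [t] is removed, the remaining
    terms are smaller than it in absolute value for small [t]. *)
Lemma poly_sign_germ p : exists2 r, 0 < r &
  exists x, forall t, 0 < t < r -> Num.sg p.[t] = x.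
Proof.
have [->|/poly_valuation[k [q [q0 ->]]]] := eqVneq p 0.
  by exists 1; rewrite ?ltr01//; exists 0 => t _; rewrite horner0 sgr0.
have [q' qE] := poly_split q; have [K [K0 hK]] := poly_bound q'.
have c0 : 0 < `|q.[0]| by rewrite normr_gt0.
have K1 : 0 < K + 1 by lra.
exists (Num.min 1 (`|q.[0]| / (K + 1))); first by rewrite lt_min ltr01 divr_gt0.
exists (Num.sg q.[0]) => t; rewrite lt_min ltr_pdivlMr // => /and3P[t0 t1 tc].
rewrite hornerM hornerXn sgrM [Num.sg (t ^+ _)]gtr0_sg ?exprn_gt0 // mulr1.
have -> : q.[t] = q.[0] + t * q'.[t] by rewrite {1}qE !hornerE.
have := hK t; rewrite (ltW t0) (ltW t1) => /(_ isT) hq.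
have {hq} : `|t * q'.[t]| < `|q.[0]|.
  rewrite normrM gtr0_norm //; apply: le_lt_trans tc.
  by rewrite ler_wpM2l ?ltW //; lra.
case: (sgrP q.[0]) q0 c0 => [->//|h _ _ hlt|h _ _ hlt].
  by apply: gtr0_sg; move: hlt; rewrite ltr_norml; lra.
by apply: ltr0_sg; move: hlt; rewrite ltr_norml; lra.
Qed.

(* Write [B = t^k (b(s) + t B'(t, s))] with [b != 0] of vanishing order [m <= d]
   at [0]: on the zero set, [s^m] is then bounded by a multiple of [t]. *)
Lemma bipoly_zeros B d : B != 0 -> (forall i, (size (B`_i)%R <= d.+1)%N) ->
  exists r C, [/\ 0 < r, 0 <= C & forall t s, 0 < t < r -> 0 < s < r ->
    B.[t%:P].[s] = 0 -> s ^+ d <= C * t].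
Proof.
move=> /poly_valuation[k [Q [b0 ->]]] hd.
have : (size Q.[0] <= d.+1)%N.
  by have := hd k; rewrite coefMXn ltnn subnn horner_coef0.
have [B' BE] := poly_split Q.
have {b0} [m [b [bn0 bE]]] := poly_valuation b0.
have bnz : b != 0 by apply: contraNneq bn0 => ->; rewrite horner0.
rewrite bE size_mulXn // => hsz.
have md : (m <= d)%N.
  move: hsz; rewrite -size_poly_gt0 in bnz; case: (size b) bnz => // j _.
  by rewrite addnS ltnS => /(leq_trans (leq_addr _ _)).
have [b' b'E] := poly_split b; have [K [K0 hK]] := poly_bound b'.
have [L [L0 hL]] := bipoly_bound B'.
have c0 : 0 < `|b.[0]| by rewrite normr_gt0.
set c := `|b.[0]| in c0 *.
have K1 : 0 < 2 * (K + 1) by lra.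
exists (Num.min 1 (c / (2 * (K + 1)))), (2 * L / c); split.
- by rewrite lt_min ltr01 divr_gt0.
- by rewrite divr_ge0 ?(ltW c0)// mulr_ge0.
move=> t s; rewrite !lt_min => /and3P[t0 t1 _].
rewrite ltr_pdivlMr // => /and3P[s0 s1 sc].
rewrite hornerM hornerXn -polyC_exp hornerM hornerC => /eqP.
rewrite mulf_eq0 expf_eq0 (gt_eqF t0) andbF orbF BE => /eqP.
rewrite hornerD hornerC hornerM hornerX hornerD hornerM hornerC.
rewrite bE hornerM hornerXn => /eqP; rewrite addr_eq0 => /eqP hz.
(* The radius for [s] makes the nonconstant part of [b] at most [c / 2]. On the zero set this gives
   [s ^+ m * (c / 2) <= L * t], whence the constant [2 * L / c]. *)
have hb : c / 2 <= `|b.[s]|.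
  rewrite b'E hornerD hornerC hornerM hornerX.
  have /hK hs : 0 <= s <= 1 by rewrite (ltW s0) (ltW s1).
  have : `|s * b'.[s]| <= c / 2.
    rewrite normrM gtr0_norm //.
    apply: (@le_trans _ _ (s * K)); last lra.
    by apply: ler_wpM2l hs; exact: ltW.
  by have := ler_normB (b.[0] + s * b'.[s]) (s * b'.[s]); rewrite addrK -/c; lra.
have hsm : s ^+ m * (c / 2) <= L * t.
  apply: (@le_trans _ _ (`|b.[s] * s ^+ m|)).
    rewrite normrM normrX (gtr0_norm s0) mulrC.
    by apply: ler_wpM2r hb; rewrite exprn_ge0 // ltW.
  rewrite hz normrN normrM (gtr0_norm t0) mulrC ler_wpM2r ?(ltW t0)//.
  by apply: hL; rewrite !ltW.
have hsd : s ^+ d <= s ^+ m by rewrite ler_wiXn2l // ltW.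
apply: le_trans hsd _.
rewrite mulrAC ler_pdivlMr //; lra.
Qed.

End PolynomialGerms.

(** * Germs of semialgebraic sets and the Lojasiewicz inequality *)

Section Germs.
Variable R : realType.

Lemma semialg_comp1 (T : R -> Prop) (g : seq R -> R) :
  semialg (fun e => T e`_0) -> sfun g -> semialg (fun e => T (g e)).
Proof. by move=> sT sg; apply: (sfun_elim (Q := fun x _ => T x)). Qed.

(** The finitely many polynomials deciding [T] each have a constant sign on a common interval next
    to 0, so [T] is constant there and can be tested at [r / 2]. *)
Lemma germ (T : R -> Prop) : semialg (fun e => T e`_0) ->
  exists2 r, 0 < r &
  (forall t, 0 < t < r -> T t) \/ (forall t, 0 < t < r -> ~ T t).
Proof.
case=> ts [rts h].
pose v i : {poly R} := if i is 0 then 'X else 0.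
have hv (t : R) (u : GRing.term R) : GRing.rterm u ->
    GRing.eval [:: t] u = (teval polyC v u).[t].
  move=> ru; rewrite evalE // -[RHS]/(horner_eval t _) teval_rmorph.
  apply: eq_teval => [x|i] /=; rewrite /horner_eval ?hornerC //.
  by case: i => [|i] /=; rewrite ?hornerX ?nth_nil ?horner0.
have [r r0 hr] : exists2 r : R, 0 < r & forall u, u \in ts ->
    forall t t', 0 < t < r -> 0 < t' < r ->
    Num.sg (GRing.eval [:: t] u) = Num.sg (GRing.eval [:: t'] u).
  elim: ts rts {h} => [|u ts ih] /=; first by exists 1; rewrite ?ltr01.
  move=> /andP[ru /ih[r r0 hr]].
  have [r1 r10 [x hx]] := poly_sign_germ (teval polyC v u).
  exists (Num.min r r1) => [|w]; first by rewrite lt_min r0.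
  rewrite inE => /predU1P[->|wts] t t'; rewrite !lt_min.
    move=> /and3P[t0 _ t1] /and3P[t0' _ t1']; rewrite !hv // !hx //.
      by rewrite t0'.
    by rewrite t0.
  by move=> /and3P[t0 t1 _] /and3P[t0' t1' _]; apply: hr; rewrite ?t0 ?t0'.
exists r => //; have hr2 : 0 < r / 2 < r by lra.
case: (pselect (T (r / 2))) => [Tr|nTr]; [left|right] => t ht.
  by apply: (h [:: r / 2] [:: t]) Tr => u hu; apply: hr.
by move=> Tt; apply: nTr; apply: (h [:: t] [:: r / 2]) Tt => u hu; apply: hr.
Qed.

(** Variable 0, the distance [t], is the outer indeterminate, and variable 1, the error [s], the
    inner one; the parameters [e] enter only as scalars. *)
Let v2 (e : seq R) i : {poly {poly R}} :=
  match i with 0 => 'X | 1 => ('X)%:P | j.+2 => (e`_j)%:P%:P end.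
Let B (e : seq R) u : {poly {poly R}} := teval (polyC \o polyC) (v2 e) u.

Let evalB t s e u : GRing.rterm u ->
  GRing.eval (t :: s :: e) u = (B e u).[t%:P].[s].
Proof.
move=> ru; rewrite evalE // -[RHS]/(horner_eval s (horner_eval t%:P _)).
rewrite !teval_rmorph; apply: eq_teval => [x|] /=; rewrite /horner_eval ?hornerC //.
by case=> [|[|i]] /=; rewrite ?hornerX ?hornerC ?hornerX ?hornerC.
Qed.

Let sizeM_coef (p q : {poly {poly R}}) d1 d2 :
  (forall i, (size (p`_i)%R <= d1.+1)%N) -> (forall i, (size (q`_i)%R <= d2.+1)%N) ->
  forall i, (size ((p * q)`_i)%R <= (d1 + d2).+1)%N.
Proof.
move=> h1 h2 i; rewrite coefM; apply: leq_trans (size_sum _ _ _) _.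
apply/bigmax_leqP => j _; apply: leq_trans (size_polyMleq _ _) _.
have := leq_add (h1 j) (h2 (i - j)%N); rewrite addSn addnS.
by case: (size _ + size _)%N.
Qed.

(** The degree in [s] is bounded by the shape of the term alone. The quantifier over [e] after [d]
    is the source of the uniformity of the exponent. *)
Let degB u : exists d, forall e i, (size ((B e u)`_i)%R <= d.+1)%N.
Proof.
rewrite /B; elim: u => /=.
- move=> i; exists 1 => e j; case: i => [|[|i]] /=; last 1 first.
  + rewrite coefC; case: ifP => _; rewrite ?size_poly0 //.
    by apply: leq_trans (size_polyC_leq1 _) _.
  + by rewrite coefX; case: eqP => _; rewrite ?size_poly1 ?size_poly0.
  + by rewrite coefC; case: ifP => _; rewrite ?size_polyX ?size_poly0.
- move=> x; exists 0 => e j; rewrite coefC; case: ifP => _; rewrite ?size_poly0 //.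
  exact: size_polyC_leq1.
- move=> n; exists 0 => e j; rewrite -polyC_natr coefC -polyC_natr.
  by case: ifP => _; rewrite ?size_poly0 // size_polyC_leq1.
- move=> u1 [d1 h1] u2 [d2 h2]; exists (maxn d1 d2) => e i.
  rewrite coefD; apply: leq_trans (size_polyD _ _) _.
  rewrite -maxnSS geq_max !leq_max.
  by rewrite h1 h2 orbT.
- by move=> u1 [d1 h1]; exists d1 => e i; rewrite coefN size_polyN.
- move=> u1 [d1 h1] n; exists d1 => e i; rewrite coefMn.
  elim: n => [|n ih]; first by rewrite mulr0n size_poly0.
  by rewrite mulrS; apply: leq_trans (size_polyD _ _) _; rewrite geq_max h1.
- move=> u1 [d1 h1] u2 [d2 h2]; exists (d1 + d2)%N => e i.
  exact: (sizeM_coef (h1 e) (h2 e)).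
- by move=> u1 _; exists 0 => e i; rewrite coef0 size_poly0.
- move=> u1 [d1 h1] n; exists (d1 * n)%N => e.
  elim: n => [|n ih] i.
    by rewrite expr0 coef1 muln0; case: eqP => _; rewrite ?size_poly0 ?size_poly1.
  by rewrite exprS mulnS; apply: sizeM_coef.
Qed.

(** Suppose [P] holds at [(t, s)]. If none of the polynomials that are nonzero for these parameters
    vanishes between [s] and [r / 2], then by the intermediate value theorem their signs agree at
    both ends, so [P] also holds at [(t, r / 2)]; this contradicts the bound [r / 4] on the errors.
    Hence one of them vanishes at some [s' >= s], and [bipoly_zeros] bounds [s']. *)
Lemma lojasiewicz (P : seq R -> Prop) : semialg P -> exists d, (0 < d)%N /\
  forall e,
  (forall eta, 0 < eta -> exists2 r, 0 < r & forall t s,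
     0 < t < r -> 0 < s -> P (t :: s :: e) -> s <= eta) ->
  exists r C, [/\ 0 < r, 0 <= C & forall t s,
     0 < t < r -> 0 < s -> P (t :: s :: e) -> s ^+ d <= C * t].
Proof.
case=> ts [rts h].
have [d [d0 hd]] : exists d, (0 < d)%N /\ forall u, u \in ts ->
    forall e i, (size ((B e u)`_i)%R <= d.+1)%N.
  elim: ts {rts h} => [|u ts [d [d0 hd]]]; first by exists 1.
  have [d1 hd1] := degB u; exists (maxn d d1); rewrite leq_max d0.
  split=> // w; rewrite inE => /predU1P[->|/hd hw] e i.
    by apply: leq_trans (hd1 _ _) _; rewrite ltnS leq_maxr.
  by apply: leq_trans (hw _ _) _; rewrite ltnS leq_maxl.
exists d; split=> // e hP.
have [r [C [r0 C0 hrC]]] : exists r C, [/\ 0 < r, 0 <= C & forall u, u \in ts ->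
    B e u != 0 -> forall t s, 0 < t < r -> 0 < s < r ->
    (B e u).[t%:P].[s] = 0 -> s ^+ d <= C * t].
  elim: ts hd {rts h} => [|u ts ih] hd.
    by exists 1, 0; split=> //; exact: ltr01.
  have [|r [C [r0 C0 hrC]]] := ih; first by move=> w hw; apply: hd; rewrite inE hw orbT.
  have [u0|un0] := eqVneq (B e u) 0.
  exists r, C; split=> // w; rewrite inE => /predU1P[->|]; last exact: hrC.
    by rewrite u0 eqxx.
  have [|r1 [C1 [r10 C10 hrC1]]] := @bipoly_zeros R _ d un0.
    by move=> i; apply: hd; rewrite inE eqxx.
  exists (Num.min r r1), (C + C1); split; rewrite ?lt_min ?r0 ?addr_ge0 //.
  move=> w; rewrite inE => hw wn0 t s; rewrite !lt_min.
  move=> /and3P[t0 tr tr1] /and3P[s0 sr sr1] hz.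
  have [C't Ct] : 0 <= C1 * t /\ 0 <= C * t by split; apply: mulr_ge0 => //; apply: ltW.
  rewrite mulrDl; case/predU1P: hw => [wu|hw].
    rewrite wu in hz; have := hrC1 t s.
    by rewrite t0 tr1 s0 sr1 hz => /(_ isT isT erefl); lra.
  by have := hrC w hw wn0 t s; rewrite t0 tr s0 sr hz => /(_ isT isT erefl); lra.
have [|r2 r20 hr2] := hP (r / 4); first by lra.
exists (Num.min r r2), C; split=> //; first by rewrite lt_min r0.
move=> t s; rewrite lt_min => /and3P[t0 tr tr2] s0 Ps.
have sr : s <= r / 4 by apply: (hr2 t) => //; rewrite t0.
case: (pselect (exists2 u, u \in ts & B e u != 0 /\ exists2 s', s <= s' <= r / 2 &
   (B e u).[t%:P].[s'] = 0)) => [[u hu [un0 [s' /andP[ss' s'r] hz]]]|hno].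
  apply: (@le_trans _ _ (s' ^+ d)).
    by rewrite lerXn2r ?nnegrE //; lra.
  by apply: (hrC u hu un0); rewrite ?t0 //; lra.
suff : r / 2 <= r / 4 by lra.
apply: (hr2 t); [by rewrite t0|lra|].
apply: h Ps => u hu; have ru := allP rts _ hu; rewrite !evalB //.
have [->|un0] := eqVneq (B e u) 0; first by rewrite !horner0.
have hnz s' : s <= s' <= r / 2 -> (B e u).[t%:P].[s'] != 0.
  by move=> hs'; apply/eqP => hz; apply: hno; exists u => //; split=> //; exists s'.
set p := (B e u).[t%:P] in hnz *.
have sr2 : s <= r / 2 by lra.
have hs : p.[s] != 0 by apply: hnz; lra.
have hr' : p.[r / 2] != 0 by apply: hnz; lra.
have iv (q : {poly R}) : q.[s] <= 0 <= q.[r / 2] -> exists2 x, s <= x <= r / 2 & root q x.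
  exact: poly_ivt.
case: (sgrP p.[s]) (hs) => [_ //|ps|ps] _.
  case: (sgrP p.[r / 2]) (hr') => [_ //|//|pr _].
  have [|x hx /eqP] := iv (- p); first by rewrite !hornerN oppr_le0 oppr_ge0 !ltW.
  by rewrite hornerN => /eqP; rewrite oppr_eq0 (negbTE (hnz _ hx)).
case: (sgrP p.[r / 2]) (hr') => [_ //|pr _|//].
have [|x hx /eqP] := iv p; first by rewrite !ltW.
by move/eqP; rewrite (negbTE (hnz _ hx)).
Qed.

End Germs.

(** * Semialgebraic functions of one variable *)

Section Choice.
Variable R : realType.
Implicit Types u : R -> R.

Lemma semialg_andb (a b : seq R -> bool) :
  semialg (fun e => a e) -> semialg (fun e => b e) ->
  semialg (fun e => a e && b e).
Proof.
move=> sa sb; apply: semialg_iff (semialg_and sa sb) => e.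
by split=> [/andP|/andP].
Qed.

Definition sfun1 u := sfun (fun e => u e`_0).

Lemma sfun1_comp u g : sfun1 u -> sfun g -> sfun (fun e => u (g e)).
Proof.
move=> su sg; apply: (sfun_elim (Q := fun x e => u x = e`_0) (sfun_drop 1 sg)).
by apply: semialg_eq su _; exact: (sfun_drop 1 (sfun_var _ 0)).
Qed.

End Choice.

(** The cases follow the syntax of the expression; the last two unfold entries of matrices and of
    shifted environments. *)
Ltac sfun_step :=
  match goal with
  | |- sfun (fun _ => ?c) => refine (sfun_const c)
  | H : sfun1 ?u |- sfun (fun e => ?u (@?g e)) => refine (@sfun1_comp _ u g H _)
  | H : semialg_fun ?f |- sfun (fun e => ?f (@?g e)) => refine (H g _); intro
  | |- sfun (fun e => Num.norm (@?g e)) => refine (@sfun_abs _ g _)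
  | |- sfun (fun e => \sum_i (@?g e i)) =>
      refine (@sfun_sum _ _ (fun i e => g e i) _); intro
  | |- sfun (fun e => @?g e + @?h e) => refine (@sfun_add _ g h _ _)
  | |- sfun (fun e => - @?g e) => refine (@sfun_opp _ g _)
  | |- sfun (fun e => @?g e * @?h e) => refine (@sfun_mul _ g h _ _)
  | |- sfun (fun e => (@?g e)^-1) => refine (@sfun_inv _ g _)
  | |- sfun (fun e => nth _ e ?i) => refine (sfun_var _ i)
  | |- sfun _ => refine (@sfun_ext _ (fun e => nth 0 e _) _ _ (sfun_var _ _));
      let e := fresh "e" in (intro e; rewrite ?mxE ?nth_drop; reflexivity)
  | |- sfun _ => eapply sfun_ext;
      [let e := fresh "e" in (intro e; rewrite !mxE; reflexivity)|]
  end.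

Ltac semialg_step :=
  match goal with
  | |- semialg (fun e => @?P e /\ @?Q e) => refine (@semialg_and _ P Q _ _)
  | |- semialg (fun e => @?P e \/ @?Q e) => refine (@semialg_or _ P Q _ _)
  | |- semialg (fun e => ~ @?P e) => refine (@semialg_not _ P _)
  | |- semialg (fun e => @?P e -> @?Q e) => refine (@semialg_imp _ P Q _ _)
  | |- semialg (fun e => is_true (@?a e && @?b e)) => refine (@semialg_andb _ a b _ _)
  | |- semialg (fun e => is_true (@?a e <= @?b e)) => refine (@semialg_le _ a b _ _)
  | |- semialg (fun e => is_true (@?a e < @?b e)) => refine (@semialg_lt _ a b _ _)
  | |- semialg (fun e => @?a e = @?b e) => refine (@semialg_eq _ a b _ _)
  | |- semialg (fun e => exists x, @?P e x) =>
      first [ refine (@semialg_ex _ (fun x e => P e x) _)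
            | refine (@semialg_exv _ _ (fun x e => P e x) _) ]
  | |- semialg (fun e => forall x, @?P e x) =>
      first [ refine (@semialg_all _ (fun x e => P e x) _)
            | refine (@semialg_allv _ _ (fun x e => P e x) _)
            | refine (@semialg_allI _ _ (fun x e => P e x) _); intro ]
  end.

Ltac semialg_tac := repeat (first [semialg_step | sfun_step]; cbv beta).

(** * Monotonicity, limits and selections in one variable *)

Section OneVariable.
Variable R : realType.
Implicit Types (u W : R -> R) (T : R -> R -> Prop).

(** Let [c] be the supremum of the points up to which [W] stays above [W x]. No continuity is at
    hand: the comparison to the left of [c] carries the bound to [c], and the one to its right
    carries it further. *)
Lemma locally_nondecreasing W a b :
  (forall t, a < t < b -> exists2 d, 0 < d &
    (forall t', t < t' < t + d -> t' < b -> W t <= W t') /\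
    (forall t', t - d < t' < t -> a < t' -> W t' <= W t)) ->
  forall x y, a < x -> x <= y -> y < b -> W x <= W y.
Proof.
move=> hW x y ax xy yb.
pose S := [set z | x <= z <= y /\ forall z', x <= z' <= z -> W x <= W z'].
have Sx : S x.
  split; first by rewrite lexx.
  by move=> z' /le_anti <-.
have hsup : has_sup S.
  by split; [exists x | exists y => z [/andP[]]].
have xc : x <= sup S by apply: ub_le_sup Sx; case: hsup.
have cy : sup S <= y by apply: ge_sup; [exists x|move=> z [/andP[]]].
set c := sup S in xc cy.
have hlt z : x <= z < c -> W x <= W z.
  move=> /andP[xz zc]; have [|z1 [_ hz1]] := sup_adherent _ hsup (eps := c - z).
    by rewrite subr_gt0.
  by rewrite -/c opprB addrC subrK => zz1; apply: hz1; rewrite xz ltW.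
have [|d d0 [dr dl]] := hW c; first by lra.
have hc : W x <= W c.
  have [->//|xnc] := eqVneq x c.
  have {xnc}xc' : x < c by rewrite lt_neqAle xnc.
  pose z := Num.max ((x + c) / 2) (c - d / 2).
  have zc : z < c by rewrite gt_max; lra.
  have xz : x < z by rewrite lt_max; apply/orP; left; lra.
  have dz : c - d < z by rewrite lt_max; apply/orP; right; lra.
  apply: le_trans (hlt z _) (dl z _ _); by [rewrite ltW|rewrite dz|lra].
have [->//|ync] := eqVneq y c.
have {ync}yc : c < y by rewrite lt_neqAle eq_sym ync.
pose z := Num.min y (c + d / 2).
have cz : c < z by rewrite lt_min yc; lra.
have zd : z < c + d by rewrite gt_min; apply/orP; right; lra.
have zy : z <= y by rewrite ge_min lexx.
suff : S z by move/(ub_le_sup (proj2 hsup)); rewrite -/c; lra.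
split=> [|z' /andP[xz' z'z]]; first by rewrite zy andbT; lra.
have [z'c|cz'|->//] := ltgtP z' c; first by apply: hlt; rewrite xz'.
apply: le_trans hc (dr z' _ _); last lra.
by rewrite cz'; lra.
Qed.

(** Code [t] by an integer [k] such that the extremum is strict within [1 / (k + 1)], by its kind,
    and by the integer part of [t * (k + 1)]. Two points with equal codes lie within each other's
    radius, so each value would be strictly beyond the other. The interval would thus be countable,
    against its positive Lebesgue measure. *)
Lemma not_all_strict_extrema u r : 0 < r ->
  (forall t, 0 < t < r -> exists2 d, 0 < d &
    (forall t', `|t' - t| < d -> t' <> t -> u t' < u t) \/
    (forall t', `|t' - t| < d -> t' <> t -> u t < u t')) -> False.
Proof.
move=> r0 hu.
have /choice[g hg] : forall t, exists p : nat * bool, 0 < t < r ->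
    forall t', `|t' - t| < p.1.+1%:R^-1 -> t' <> t ->
    if p.2 then u t' < u t else u t < u t'.
  move=> t; case: (pselect (0 < t < r)) => [/hu[d d0 hd]|]; last by exists (0, true).
  have [k hk] : exists k : nat, k.+1%:R^-1 < d.
    exists (Num.truncn d^-1); rewrite invf_plt ?posrE ?ltr0Sn //.
    exact: truncnS_gt.
  case: hd => hd; [exists (k, true)|exists (k, false)] => _ t' ht' tt';
    by apply: hd => //; apply: lt_trans hk.
have : countable `]0, r[%classic.
  apply/countable_injP.
  exists (fun t => pickle ((g t).1, (g t).2, Num.floor (t * (g t).1.+1%:R))).
  move=> t t'; rewrite !inE /= !in_itv /= => ht ht' /(pcan_inj pickleK).
  case=> h1 h2 h3; apply: contrapT => tt'.
  have dt : `|t' - t| < (g t).1.+1%:R^-1.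
    have k0 : 0 < (g t).1.+1%:R :> R by rewrite ltr0Sn.
    rewrite -[X in _ < X]mul1r ltr_pdivlMr // -{1}(gtr0_norm k0) -normrM mulrBl.
    rewrite -h1 in h3.
    have /andP[] := floor_itv (t' * (g t).1.+1%:R); rewrite -h3 intrD mulr1z.
    have /andP[] := floor_itv (t * (g t).1.+1%:R); rewrite intrD.
    rewrite mulr1z ltr_norml; lra.
  have := hg t ht t' dt (fun h => tt' (esym h)).
  rewrite distrC in dt; rewrite h1 in dt.
  have := hg t' ht' t dt tt'; rewrite -h2.
  by case: ifP => _ h4 h5; have := lt_trans h4 h5; rewrite ltxx.
move/countable_lebesgue_measure0; rewrite lebesgue_measure_itv /= lte_fin r0.
by rewrite oppr0 adde0 => /eqP; rewrite eqe (gt_eqF r0).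
Qed.

Lemma germ_right (T : R -> Prop) t : semialg (fun e => T e`_0) ->
  exists2 d, 0 < d &
  (forall t', t < t' < t + d -> T t') \/ (forall t', t < t' < t + d -> ~ T t').
Proof.
move=> sT; have [|d d0 hd] := @germ R (fun h => T (t + h)).
  by apply: (semialg_comp1 sT); semialg_tac.
exists d => //; case: hd => hd; [left|right] => t' /andP[h1 h2];
  by rewrite -[t'](addrNK t) addrC; apply: hd; rewrite subr_gt0 ltrBlDl h1.
Qed.

Lemma germ_left (T : R -> Prop) t : semialg (fun e => T e`_0) ->
  exists2 d, 0 < d &
  (forall t', t - d < t' < t -> T t') \/ (forall t', t - d < t' < t -> ~ T t').
Proof.
move=> sT; have [|d d0 hd] := @germ R (fun h => T (t - h)).
  by apply: (semialg_comp1 sT); semialg_tac.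
exists d => //; case: hd => hd; [left|right] => t' /andP[h1 h2];
  by rewrite (_ : t' = t - (t - t')); [apply: hd; lra|lra].
Qed.

(** Near 0, [inc] holds everywhere or nowhere, and so does [dec]. If one holds everywhere, local
    monotonicity becomes global. If neither holds anywhere, the one-sided germs of [u] against its
    value at [t] leave only a strict extremum at every [t], which is impossible. *)
Lemma sfun1_monotone u : sfun1 u -> exists2 r, 0 < r &
  (forall x y, 0 < x -> x <= y -> y < r -> u x <= u y) \/
  (forall x y, 0 < x -> x <= y -> y < r -> u y <= u x).
Proof.
move=> su.
pose inc t := exists d : R, 0 < d /\ ((forall t' : R, t < t' < t + d -> u t <= u t') /\
  (forall t' : R, t - d < t' < t -> u t' <= u t)).
pose dec t := exists d : R, 0 < d /\ ((forall t' : R, t < t' < t + d -> u t' <= u t) /\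
  (forall t' : R, t - d < t' < t -> u t <= u t')).
have [|r1 r10 [hinc|hninc]] := @germ R inc; first by rewrite /inc; semialg_tac.
  exists r1 => //; left; apply: locally_nondecreasing => t /hinc[d [d0 [h1 h2]]].
  by exists d => //; split=> t' ht' _; [apply: h1|apply: h2].
have [|r2 r20 [hdec|hndec]] := @germ R dec; first by rewrite /dec; semialg_tac.
  exists r2 => //; right=> x y x0 xy yr; rewrite -lerN2.
  apply: (@locally_nondecreasing (fun x => - u x) 0 r2) => // t /hdec[d [d0 [h1 h2]]].
  by exists d => //; split=> t' ht' _; rewrite lerN2; [apply: h1|apply: h2].
exfalso; apply: (@not_all_strict_extrema u (Num.min r1 r2)).
  by rewrite lt_min r10.
move=> t; rewrite lt_min => /and3P[t0 t1 t2].
have nit : ~ inc t by apply: hninc; rewrite t0.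
have ndt : ~ dec t by apply: hndec; rewrite t0.
have [|d1 d10 ru] := @germ_right (fun x => u t <= u x) t; first by semialg_tac.
have [|d2 d20 lu] := @germ_left (fun x => u x <= u t) t; first by semialg_tac.
have [|d3 d30 rd] := @germ_right (fun x => u x <= u t) t; first by semialg_tac.
have [|d4 d40 ld] := @germ_left (fun x => u t <= u x) t; first by semialg_tac.
pose d := Num.min (Num.min d1 d2) (Num.min d3 d4).
have [dd1 dd2 dd3 dd4] : [/\ d <= d1, d <= d2, d <= d3 & d <= d4].
  by rewrite /d !ge_min !lexx !orbT.
have d0 : 0 < d by rewrite !lt_min d10 d20 d30.
have hr (T : R -> Prop) d' : d <= d' -> (forall t', t < t' < t + d' -> T t') ->
    forall t', t < t' < t + d -> T t'.
  by move=> dd' h t' ht'; apply: h; lra.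
have hl (T : R -> Prop) d' : d <= d' -> (forall t', t - d' < t' < t -> T t') ->
    forall t', t - d < t' < t -> T t'.
  by move=> dd' h t' ht'; apply: h; lra.
have hd2 : t < t + d / 2 < t + d by lra.
have hd2' : t - d < t - d / 2 < t by lra.
exists d => //.
case: ru => /(hr _ _ dd1) ru.
  have {}lu : forall t', t - d < t' < t -> u t < u t'.
    case: lu => /(hl _ _ dd2) lu; first by case: nit; exists d.
    by move=> t' /lu /negP; rewrite -ltNge.
  case: rd => /(hr _ _ dd3) rd.
    by case: ndt; exists d; split=> //; split=> // t' /lu /ltW.
  right=> t'; rewrite ltr_norml => /andP[h1 h2] tt'.
  have [tt|tt|//] := ltgtP t' t; first by apply: lu; lra.
  by rewrite ltNge; apply/negP => ?; apply: (rd t'); [lra|].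
left=> t'; rewrite ltr_norml => /andP[h1 h2] tt'.
have {}ru : forall t', t < t' < t + d -> u t' < u t.
  by move=> x /ru /negP; rewrite -ltNge.
have [tt|tt|//] := ltgtP t' t; last by apply: ru; lra.
case: ld => /(hl _ _ dd4) ld.
  by case: ndt; exists d; split=> //; split=> // x /ru /ltW.
by rewrite ltNge; apply/negP => ?; apply: (ld t'); [lra|].
Qed.

(** The limit is the supremum of the eventual lower bounds: by [germ], [u] is eventually above
    [sup A + eta], which contradicts the supremum, or eventually below it. *)
Lemma sfun1_limit u r K : 0 < r -> sfun1 u ->
  (forall t, 0 < t < r -> `|u t| <= K) ->
  exists l, forall eta, 0 < eta -> exists2 d, 0 < d &
    forall t, 0 < t < d -> `|u t - l| <= eta.
Proof.
move=> r0 su uK.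
pose A := [set c | exists2 d, 0 < d & forall t, 0 < t < d -> c <= u t].
have hsup : has_sup A.
  split.
    by exists (- K), r => // t /uK; rewrite ler_norml => /andP[].
  exists K => c [d d0 hd]; pose t := Num.min d r / 2.
  have m0 : 0 < Num.min d r by rewrite lt_min d0.
  have [hmd hmr] : Num.min d r <= d /\ Num.min d r <= r.
    by rewrite !ge_min !lexx orbT.
  have /hd h1 : 0 < t < d by rewrite /t; lra.
  have /uK h2 : 0 < t < r by rewrite /t; lra.
  by move: h2; rewrite ler_norml => /andP[_]; apply: le_trans.
exists (sup A) => eta eta0.
have [c [d d0 hd] hc] := sup_adherent eta0 hsup.
have [|d' d'0 hd'] := @germ R (fun t => sup A + eta <= u t); first by semialg_tac.
case: hd' => hd'.
  have : A (sup A + eta) by exists d'.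
  by move/(ub_le_sup (proj2 hsup)); lra.
exists (Num.min d d') => [|t]; first by rewrite lt_min d0.
rewrite lt_min => /and3P[t0 td td'].
have h1 : c <= u t by apply: hd; rewrite t0.
have /negP : ~ sup A + eta <= u t by apply: hd'; rewrite t0.
by rewrite -ltNge ler_norml; lra.
Qed.

(* The least element of a fibre when it exists; otherwise the midpoint of the
   maximal interval of the fibre starting at its infimum. *)
Lemma semialg_choice T K : semialg (fun e => T e`_0 e`_1) ->
  (forall s x, T s x -> `|x| <= K) ->
  exists2 u, sfun1 u & forall s, (exists x, T s x) -> T s (u s).
Proof.
move=> sT TK.
pose least s m := T s m /\ forall x : R, x < m -> ~ T s x.
pose mid s m := exists a b : R, [/\ a < b, m = (a + b) / 2,
   forall x : R, x <= a -> ~ T s x, forall x : R, a < x < b -> T s x &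
   forall b' : R, b < b' -> exists x : R, a < x < b' /\ ~ T s x].
pose C s m := least s m \/ (~ (exists m' : R, least s m') /\ mid s m).
have leastU s m m' : least s m -> least s m' -> m = m'.
  move=> [Tm hm] [Tm' hm'].
  by have [/hm'//|/hm//|//] := ltgtP m m'.
have midU s m m' : mid s m -> mid s m' -> m = m'.
  move=> [a [b [ab -> ha hb hb']]] [a' [b' [a'b' -> ha' hb2 hb2']]].
  have aa' : a = a'.
    have [aa'|aa'|//] := ltgtP a a'.
      case: (ha' ((a + Num.min a' b) / 2)); last apply: hb;
        have : Num.min a' b <= a' by rewrite ge_min lexx.
        by lra.
      have : a < Num.min a' b by rewrite lt_min aa'.
      have : Num.min a' b <= b by rewrite ge_min lexx orbT.
      by lra.
    case: (ha ((a' + Num.min a b') / 2)); last apply: hb2;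
      have : Num.min a b' <= a by rewrite ge_min lexx.
      by lra.
    have : a' < Num.min a b' by rewrite lt_min aa'.
    have : Num.min a b' <= b' by rewrite ge_min lexx orbT.
    by lra.
  subst a'; suff -> : b = b' by [].
  have [bb'|bb'|//] := ltgtP b b'.
    by have [x [hx []]] := hb' _ bb'; apply: hb2.
  by have [x [hx []]] := hb2' _ bb'; apply: hb.
have CU s m m' : C s m -> C s m' -> m = m'.
  move=> [lm|[nl hm]] [lm'|[nl' hm']]; [exact: leastU lm lm'| | |exact: midU hm hm'].
    by case: nl'; exists m.
  by case: nl; exists m'.
have CT s m : C s m -> T s m.
  move=> [[]//|[_ [a [b [ab -> _ h _]]]]]; by apply: h; lra.
have Cex s : (exists x, T s x) -> exists m, C s m.
  move=> [x0 Tx0]; case: (pselect (exists m', least s m')) => [[m lm]|nl].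
    by exists m; left.
  suff [m hm] : exists m, mid s m by exists m; right.
  have hinf : has_inf [set x | T s x].
    split; first by exists x0.
    by exists (- K) => x /TK; rewrite ler_norml => /andP[].
  pose a := inf [set x | T s x].
  have ale x : T s x -> a <= x by move=> Tx; apply: (ge_inf (proj2 hinf)).
  have nTa : ~ T s a.
    move=> Ta; apply: nl; exists a; split=> // x xa /ale; by rewrite leNgt xa.
  have [|d d0 hd] := @germ_right (T s) a.
    by apply: (sfun_elim (Q := fun x e => T x e`_0) (sfun_const s));
       apply: semialg_iff sT => e; rewrite nth_drop.
  have {}hd : forall t', a < t' < a + d -> T s t'.
    case: hd => // hd; have [x Tx xa] := inf_adherent d0 hinf.
    have : a < x.
      by rewrite lt_neqAle ale // andbT; apply/eqP => ax; apply: nTa; rewrite ax.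
    by move=> ax; case: (hd x) => //; rewrite ax.
  pose B := [set b | a < b /\ forall x, a < x < b -> T s x].
  have hsup : has_sup B.
    split; first by exists (a + d); split=> //; lra.
    exists (K + 1) => b [ab hb]; rewrite leNgt; apply/negP => Kb.
    (* A point of the interval beyond [K], which the bound on [T] forbids; hence [B] is bounded
       above. *)
    have : T s (Num.max ((a + b) / 2) ((K + 1 + b) / 2)).
      by apply: hb; rewrite lt_max gt_max; apply/andP; split; [apply/orP; left; lra|lra].
    by move/TK/(le_trans (ler_norm _)); rewrite ge_max; lra.
  have ab : a + d <= sup B.
    by apply: (ub_le_sup (proj2 hsup)); split=> //; lra.
  exists ((a + sup B) / 2), a, (sup B); split=> //; first lra.
  - by move=> x xa Tx; apply: nTa; have -> : a = x by apply/le_anti; rewrite xa ale.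
  - move=> x /andP[ax xB]; have [|b [_ hb] xb] := sup_adherent _ hsup (eps := sup B - x).
      by rewrite subr_gt0.
    by apply: hb; rewrite ax; lra.
  - move=> b' hb'; apply: contrapT => nx.
    have : B b'.
      split; first lra.
      by move=> x hx; apply: contrapT => nTx; apply: nx; exists x.
    by move/(ub_le_sup (proj2 hsup)); rewrite leNgt hb'.
(* [C] has at most one solution but may have none; the default 0 makes [u] total while keeping its
   graph definable. *)
have /choice[u hu] : forall s, exists y, C s y \/ ((~ exists m : R, C s m) /\ y = 0).
  move=> s; case: (pselect (exists m, C s m)) => [[m Cm]|nC].
    by exists m; left.
  by exists 0; right.
exists u; last by move=> s /Cex[m Cm]; case: (hu s) => [/CT//|[[]]]; exists m.
apply: (@semialg_iff _ (fun e => C e`_1 e`_0 \/ ((~ exists m : R, C e`_1 m) /\ e`_0 = 0))).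
  move=> e; rewrite nth_drop; split=> [|<-]; last exact: hu.
  case: (hu e`_1) => [h1|[h1 ->]] [h2|[h2 ->]] //.
  - exact: CU h1 h2.
  - by case: h2; exists (u e`_1).
  - by case: h1; exists e`_0.
have sT2 g h : sfun g -> sfun h -> semialg (fun e => T (g e) (h e)).
  move=> sg sh; apply: (sfun_elim (Q := fun x e => T x (h e)) sg).
  apply: (sfun_elim (Q := fun y e => T e`_0 y) (sfun_drop 1 sh)).
  (* The two eliminations leave the values of [g] and [h] in reverse order in the environment. *)
  pose tau i := GRing.Var R (if i is 0 then 1 else if i is 1 then 0 else i)%N.
  have := @semialg_subst _ (fun e => T e`_0 e`_1) tau
    (fun e => [:: e`_1, e`_0 & drop 2 e]) _ _ sT.
  move=> hs; apply: semialg_iff (hs _ _) => [e|//|]; first by rewrite nth_drop.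
  by move=> e [|[|i]] //=; rewrite nth_drop.
have scl g h : sfun g -> sfun h -> semialg (fun e => least (g e) (h e)).
  move=> sg sh; apply: semialg_and; first exact: sT2.
  have sg1 := sfun_drop 1 sg; have sh1 := sfun_drop 1 sh.
  apply: (semialg_all (P := fun x e => x < h e -> ~ T (g e) x)).
  apply: semialg_imp; first exact: semialg_lt (sfun_var _ 0) sh1.
  by apply/semialg_not/sT2 => //; exact: sfun_var.
have scm g h : sfun g -> sfun h -> semialg (fun e => mid (g e) (h e)).
  move=> sg sh.
  have sg1 := sfun_drop 1 (sfun_drop 1 sg); have sh1 := sfun_drop 1 (sfun_drop 1 sh).
  have sg2 := sfun_drop 1 sg1; have sg3 := sfun_drop 1 sg2.
  apply: (semialg_ex (P := fun a e => exists b, [/\ a < b, h e = (a + b) / 2,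
   forall x : R, x <= a -> ~ T (g e) x, forall x : R, a < x < b -> T (g e) x &
   forall b' : R, b < b' -> exists x : R, a < x < b' /\ ~ T (g e) x])).
  apply: (semialg_ex (P := fun b e => [/\ e`_0 < b, h (drop 1 e) = (e`_0 + b) / 2,
   forall x : R, x <= e`_0 -> ~ T (g (drop 1 e)) x,
   forall x : R, e`_0 < x < b -> T (g (drop 1 e)) x &
   forall b' : R, b < b' -> exists x : R, e`_0 < x < b' /\ ~ T (g (drop 1 e)) x])).
  apply: (@semialg_iff _ (fun e => (drop 1 e)`_0 < e`_0 /\
    (h (drop 1 (drop 1 e)) = ((drop 1 e)`_0 + e`_0) / 2 /\
    ((forall x : R, x <= (drop 1 e)`_0 -> ~ T (g (drop 1 (drop 1 e))) x) /\
    ((forall x : R, (drop 1 e)`_0 < x < e`_0 -> T (g (drop 1 (drop 1 e))) x) /\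
    (forall b' : R, e`_0 < b' -> exists x : R,
       (drop 1 e)`_0 < x < b' /\ ~ T (g (drop 1 (drop 1 e))) x)))))).
    by move=> e; split=> [[? [? [? []]]]|[]].
  semialg_tac; try exact: sh1; try (apply: sT2; [exact: sg2|exact: sfun_var]).
  by apply: sT2; [exact: sg3|exact: sfun_var].
have s0 := sfun_var R 0; have s1 := sfun_var R 1.
have s2 := sfun_drop 1 s1.
apply: semialg_or.
  apply: semialg_or; first exact: scl.
  apply: semialg_and; last exact: scm.
  apply: semialg_not; apply: (semialg_ex (P := fun m e => least e`_1 m)).
  exact: scl.
apply: semialg_and; last exact: semialg_eq s0 (sfun_const 0).
apply: semialg_not; apply: (semialg_ex (P := fun m e => C e`_1 m)).
apply: semialg_or; first exact: scl.
apply: semialg_and; last exact: scm.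
apply: semialg_not.
apply: (semialg_ex (P := fun m e => least (drop 1 e)`_1 m)).
by apply: scl => //; exact: (sfun_drop 1 s2).
Qed.

End OneVariable.

(** * First-order errors of Lipschitz semialgebraic functions *)

Section Norm1.
Variables (R : realType) (n : nat).
Implicit Types (v w h : 'rV[R]_n).

(** The 1-norm is used because it is built from absolute values alone, and because along a curve
    with monotone coordinates its increments are those of a signed sum of the coordinates. *)
Definition norm1 v : R := \sum_i `|v 0 i|.
Definition dot w v : R := \sum_i w 0 i * v 0 i.

Lemma norm1_ge0 v : 0 <= norm1 v.
Proof. exact: sumr_ge0. Qed.

Lemma ler_norm1D v w : norm1 (v + w) <= norm1 v + norm1 w.
Proof. by rewrite -big_split; apply: ler_sum => i _; rewrite mxE ler_normD. Qed.

Lemma norm1Z (a : R) v : norm1 (a *: v) = `|a| * norm1 v.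
Proof. by rewrite mulr_sumr; apply: eq_bigr => i _; rewrite mxE normrM. Qed.

Lemma norm1N v : norm1 (- v) = norm1 v.
Proof. by apply: eq_bigr => i _; rewrite mxE normrN. Qed.

Lemma norm10 : norm1 0 = 0.
Proof. by rewrite /norm1 big1 // => i _; rewrite mxE normr0. Qed.

Lemma le_coord_norm1 v i : `|v 0 i| <= norm1 v.
Proof. by rewrite /norm1 (bigD1 i) //= lerDl sumr_ge0. Qed.

Lemma norm1_eq0 v : norm1 v = 0 -> v = 0.
Proof.
move=> v0; apply/rowP => i; rewrite mxE; apply/eqP.
by rewrite -normr_le0 -v0 le_coord_norm1.
Qed.

Lemma dotDr w v v' : dot w (v + v') = dot w v + dot w v'.
Proof. by rewrite -big_split; apply: eq_bigr => i _; rewrite mxE mulrDr. Qed.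

Lemma dotZr w (a : R) v : dot w (a *: v) = a * dot w v.
Proof. by rewrite mulr_sumr; apply: eq_bigr => i _; rewrite mxE mulrCA. Qed.

Lemma dotNl w v : dot (- w) v = - dot w v.
Proof. by rewrite -sumrN; apply: eq_bigr => i _; rewrite mxE mulNr. Qed.

Lemma dot0r w : dot w 0 = 0.
Proof. by rewrite /dot big1 // => i _; rewrite mxE mulr0. Qed.

(** Differentiability at [y] with gradient [w], spelled out with quantifiers over reals and vectors
    only so that it is a first-order condition; [dird] below has the same purpose. *)
Definition grad (f : 'rV[R]_n -> R) (y w : 'rV[R]_n) :=
  forall c : R, 0 < c -> exists d : R, 0 < d /\ forall h : 'rV[R]_n,
    norm1 h <= d -> `|f (y + h) - f y - dot w h| <= c * norm1 h.

Definition dird (f : 'rV[R]_n -> R) (x h : 'rV[R]_n) (l : R) :=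
  forall c : R, 0 < c -> exists d : R, 0 < d /\ forall t : R, 0 < t < d ->
    `|f (x + t *: h) - f x - t * l| <= c * t.

Definition lip_near (f : 'rV[R]_n -> R) (x : 'rV[R]_n) (L r : R) :=
  forall y z, norm1 (y - x) <= r -> norm1 (z - x) <= r ->
  `|f y - f z| <= L * norm1 (y - z).

End Norm1.

(** * Selection of semialgebraic curves *)

Section CurveChoice.
Variable R : realType.

(** One coordinate at a time: the first is selected among the values that can be completed, then
    substituted as a function of [s] before the others are selected. *)
Lemma semialg_choices n (P : seq R -> Prop) K : semialg P ->
  exists u : R -> seq R, (forall i, sfun1 (fun s => (u s)`_i)) /\
  forall s, (exists l, [/\ size l = n, forall i : 'I_n, `|l`_i| <= K & P (s :: l)]) ->
  [/\ size (u s) = n, forall i : 'I_n, `|(u s)`_i| <= K & P (s :: u s)].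
Proof.
elim: n P => [|n ih] P sP.
  exists (fun=> [::]); split=> [i|s [l []]]; first exact: sfun_const.
  by move=> /size0nil ->.
pose T s x := `|x| <= K /\
  exists l, size l = n /\ ((forall i : 'I_n, `|l`_i| <= K) /\ P [:: s, x & l]).
have [||u1 su1 hu1] := @semialg_choice R T K.
- apply: semialg_and; first by semialg_tac.
  apply: (@semialg_exn _ _ (fun l e =>
    (forall i : 'I_n, `|l`_i| <= K) /\ P [:: e`_0, e`_1 & l])).
  apply: semialg_and.
    apply: semialg_allI => i; apply: semialg_le; last exact: sfun_const.
    apply: sfun_abs; apply: (sfun_ext _ (sfun_var _ i)) => e.
    by rewrite nth_mkseq.
  pose tau i : GRing.term R := match i with 0 => GRing.Var R n | 1 => GRing.Var R n.+1
    | j.+2 => if (j < n)%N then GRing.Var R j else GRing.NatConst R 0 end.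
  apply: (semialg_subst (tau := tau) _ _ sP) => [[|[|i]] /=|e [|[|i]] /=] //.
  + by case: ifP.
  + by rewrite nth_drop addn0.
  + by rewrite nth_drop addn1.
  + case: ltnP => hi /=; first by rewrite nth_mkseq.
    by rewrite nth_default // size_mkseq.
- by move=> s x [].
have [|u2 [su2 hu2]] := ih (fun e => P [:: e`_0, u1 e`_0 & drop 1 e]).
  apply: (sfun_elim (Q := fun x e => P [:: e`_0, x & drop 1 e]) su1).
  pose tau i := GRing.Var R (match i with 0 => 1 | 1 => 0 | j => j end)%N.
  apply: (semialg_subst (tau := tau) _ _ sP) => [//|e [|[|i]] /=];
    by rewrite ?drop_drop ?nth_drop.
exists (fun s => u1 s :: u2 s); split; first by case=> [|i] //=.
move=> s [l0 []]; case: l0 => // x l [sl] hl Pl.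
have /hu1[h1 [l' [h2 [h3 h4]]]] : exists x, T s x.
  exists x; split; first exact: (hl ord0).
  by exists l; split=> //; split=> // i; apply: (hl (lift ord0 i)).
have [|h5 h6] := hu2 s.
  by exists l'; split=> //=; rewrite drop0.
rewrite /= drop0 => h7; split=> //=; first by rewrite h5.
by move=> i; case: (unliftP ord0 i) => [j|] -> //=; apply: h6.
Qed.

Lemma curve_choice n (P : R -> 'rV[R]_n -> Prop) (K : R) :
  semialg (fun e => P e`_0 (\row_i e`_i.+1)) ->
  exists u : R -> 'rV[R]_n, (forall i, sfun1 (fun s => u s 0 i)) /\
  forall s, (exists v : 'rV[R]_n, (forall i, `|v 0 i| <= K) /\ P s v) -> P s (u s).
Proof.
move=> sP; have [u [su hu]] := @semialg_choices n _ K sP.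
exists (fun s => \row_i (u s)`_i); split=> [i|s [v [vK Pv]]].
  by apply: (sfun_ext _ (su i)) => e; rewrite mxE.
have [l sl lv] := row_of_seq v.
have [|_ _] := hu s; last exact.
exists l; split=> //= [i|]; last by rewrite lv.
by have := vK i; rewrite -lv mxE.
Qed.

End CurveChoice.

(** * Increments of the slope at a point with a large first-order error *)

Section Core.
Variables (R : realType) (n : nat).
Implicit Types (f : 'rV[R]_n -> R) (x y h w : 'rV[R]_n).

(** The extra 1 is the tolerance at which differentiability is used, on a multiple of [h] short
    enough for the Lipschitz bound. *)
Lemma grad_le f x L r y w : lip_near f x L r -> norm1 (y - x) < r -> grad f y w ->
  forall h, `|dot w h| <= (L + 1) * norm1 h.
Proof.
move=> lip yr /(_ 1 ltr01)[d [d0 hd]] h.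
have [h0|hn0] := eqVneq (norm1 h) 0.
  by rewrite (norm1_eq0 h0) dot0r norm10 mulr0 normr0.
have hp : 0 < norm1 h by rewrite lt_neqAle eq_sym hn0 norm1_ge0.
pose c := Num.min d (r - norm1 (y - x)) / norm1 h.
have c0 : 0 < c by rewrite divr_gt0 // lt_min d0 subr_gt0.
have cn : norm1 (c *: h) = Num.min d (r - norm1 (y - x)).
  by rewrite norm1Z gtr0_norm // /c divfK.
have [m1 m2] : norm1 (c *: h) <= d /\ norm1 (c *: h) <= r - norm1 (y - x).
  by rewrite cn !ge_min !lexx orbT.
have h1 := hd _ m1.
have h2 : `|f (y + c *: h) - f y| <= L * norm1 (c *: h).
  have := lip (y + c *: h) y; rewrite [_ - y]addrC addKr; apply; last exact: ltW.
  by rewrite addrAC; apply: le_trans (ler_norm1D _ _) _; lra.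
have : `|dot w (c *: h)| <= (L + 1) * norm1 (c *: h).
  by move: h1 h2; rewrite !ler_norml; lra.
by rewrite dotZr norm1Z normrM mulrCA ler_pM2l // gtr0_norm.
Qed.

(** Write [y' - y = D us + s' (us' - us)]. A first-order expansion at [y] turns [s' (a' - a)] into
    [D (dot w us - a)] plus terms controlled by [s' U], and the assumption on the error says
    precisely that [dot w us - a < - eta]. No closeness of [us'] to [us] is assumed, so [y'] can be
    too far from [y] for the expansion. *)
Lemma increment f x L r eta s (us w : 'rV[R]_n) :
  lip_near f x L r -> 0 <= L -> 0 < eta -> 0 < s < r -> norm1 us <= 1 ->
  grad f (x + s *: us) w ->
  eta * s < f (x + s *: us) - f x - s * dot w us ->
  exists2 d, 0 < d & forall s' us', 0 < s' -> `|s' - s| < d -> norm1 us' <= 1 ->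
  let D := s' - s in let U := norm1 (us' - us) in
  let a := (f (x + s *: us) - f x) / s in
  let a' := (f (x + s' *: us') - f x) / s' in
  (0 < D -> s' * (a' - a) <= - (eta / 2) * D + (L + 2) * (s' * U)) /\
  (D < 0 -> s' * (a - a') <= (eta / 2) * D + (L + 2) * (s' * U)).
Proof.
move=> lip L0 eta0 /andP[s0 sr] us1 gw hw.
have ns : forall s' us', 0 < s' -> norm1 us' <= 1 -> norm1 (x + s' *: us' - x) <= s'.
  move=> s' us' s'0 hus'.
  by rewrite [_ - x]addrC addKr norm1Z gtr0_norm // ler_piMr // ltW.
have gb := grad_le lip (le_lt_trans (ns _ _ s0 us1) sr) gw.
(* The bound [eta / 2] leaves half of the drop [eta]; the bound 1 raises the factor [L + 1] from the
   gradient to [L + 2]. *)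
pose k := Num.min (eta / 2) 1.
have k0 : 0 < k by rewrite lt_min ltr01 andbT; lra.
have [k1 k2] : k <= eta / 2 /\ k <= 1 by rewrite !ge_min !lexx orbT.
have [dl [dl0 hdl]] := gw k k0.
pose M := 2 * L + eta / 2 + 2.
have M0 : 0 < M by rewrite /M; lra.
exists (Num.min (r - s) (2 * dl / M)).
  by rewrite lt_min subr_gt0 sr divr_gt0 // mulr_gt0.
move=> s' us' s'0; rewrite lt_min ltr_pdivlMr // => /andP[s'r s'd] us'1 D U a a'.
have U0 : 0 <= U by apply: norm1_ge0.
have s'r' : s' <= r by move: s'r; rewrite ltr_norml; lra.
set y := x + s *: us in hw gw hdl a *; set y' := x + s' *: us' in a' *.
have yy' : y' - y = D *: us + s' *: (us' - us).
  by apply/rowP => i; rewrite /y' /y /D !mxE; ring.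
have nyy' : norm1 (y' - y) <= `|D| + s' * U.
  rewrite yy'; apply: le_trans (ler_norm1D _ _) _.
  by rewrite !norm1Z (gtr0_norm s'0) lerD2r ler_piMr.
have aE : f y - f x = a * s by rewrite /a divfK // gt_eqF.
have a'E : f y' - f x = a' * s' by rewrite /a' divfK // gt_eqF.
have W0 : 0 <= s' * U by rewrite mulr_ge0 // ltW.
rewrite -/D in s'd s'r.
set Z := s' * U in W0 nyy' *.
have aL : `|a| <= L.
  rewrite -(ler_pM2r s0) -{1}(gtr0_norm s0) -normrM -aE.
  apply: le_trans (lip y x _ _) _.
  - by apply: le_trans (ns _ _ s0 us1) _; apply: ltW.
  - by rewrite subrr norm10; lra.
  - by apply: ler_wpM2l => //; apply: ns.
have sE : s' = s + D by rewrite /D addrC subrK.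
have aas : s' * (a' - a) = (f y' - f y) - a * D.
  by rewrite mulrBr mulrC -a'E sE (mulrDl s) (mulrC s) -aE; ring.
have aas' : s' * (a - a') = - ((f y' - f y) - a * D) by rewrite -aas; ring.
rewrite aas aas'.
have hZ : 0 <= L * Z by apply: mulr_ge0.
have [near|far] := leP (norm1 (y' - y)) dl.
  have := hdl _ near; rewrite [y + _]addrC subrK yy' dotDr !dotZr -yy'.
  have : `|s' * dot w (us' - us)| <= (L + 1) * Z.
    by rewrite normrM (gtr0_norm s'0) /Z mulrCA ler_pM2l // gb.
  have hb : dot w us - a < - eta.
    by rewrite -(ltr_pM2l s0) mulrBr (mulrC s a) -aE; lra.
  set b := dot w us in hb *; set g := s' * dot w _; rewrite ler_norml => /andP[g1 g2].
  have kD : k * norm1 (y' - y) <= eta / 2 * `|D| + Z.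
    apply: le_trans (ler_wpM2l (ltW k0) nyy') _; rewrite mulrDr lerD //.
      by rewrite ler_wpM2r.
    by rewrite ler_piMl.
  move/le_trans/(_ kD); rewrite ler_norml => /andP[e1 e2].
  split=> D0.
    have : D * (b - a) <= D * - eta by rewrite ler_pM2l // ltW.
    by move: e1 e2; rewrite (gtr0_norm D0); lra.
  have : D * - eta <= D * (b - a) by rewrite ler_nM2l // ltW.
  by move: e1 e2; rewrite (ltr0_norm D0); lra.
(* Far case: [D] is small against [dl], so it is [s' U] that makes [y' - y] large. Lipschitz bounds
   give at most [2 L |D| + L Z], and the choice of [M] yields [(2 L + eta / 2) |D| <= 2 Z], which
   absorbs the difference. *)
have h1 : `|f y' - f y| <= L * (`|D| + Z).
  apply: le_trans (lip y' y _ _) _.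
  - by apply: le_trans (ns _ _ s'0 us'1) _.
  - by apply: le_trans (ns _ _ s0 us1) _; apply: ltW.
  - exact: ler_wpM2l.
have h2 : `|a * D| <= L * `|D| by rewrite normrM ler_wpM2r.
have h3 : M * `|D| <= 2 * (`|D| + Z) by rewrite mulrC; lra.
move: h1 h2; rewrite !ler_norml mulrDr => /andP[l1 l2] /andP[l3 l4].
rewrite /M in h3.
by split=> D0; [rewrite (gtr0_norm D0) in h3 l1 l2 l3 l4|
  rewrite (ltr0_norm D0) in h3 l1 l2 l3 l4]; lra.
Qed.
End Core.

(** * First-order errors are negligible *)

Section Qualitative.
Variables (R : realType) (n : nat).
Implicit Types (f : 'rV[R]_n -> R) (x y h w : 'rV[R]_n).

Lemma finite_min (I : finType) (g : I -> R) : (forall i, 0 < g i) ->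
  exists2 r, 0 < r & forall i, r <= g i.
Proof.
move=> g0; suff h (s : seq I) : exists2 r, 0 < r & forall i, i \in s -> r <= g i.
  by have [r r0 hr] := h (enum I); exists r => // i; apply: hr; rewrite mem_enum.
elim: s => [|i s [r r0 hr]]; first by exists 1.
exists (Num.min (g i) r) => [|j]; first by rewrite lt_min g0.
rewrite inE => /predU1P[->|/hr jr]; first by rewrite ge_min lexx.
by rewrite ge_min jr orbT.
Qed.

Lemma min4_le (a b c d : R) : let m := Num.min (Num.min a b) (Num.min c d) in
  [/\ m <= a, m <= b, m <= c & m <= d].
Proof. by rewrite /= !ge_min !lexx !orbT. Qed.

Lemma ler_norm_div (x s K : R) : 0 < s -> (`|x / s| <= K) = (`|x| <= K * s).
Proof. by move=> s0; rewrite normrM normfV (gtr0_norm s0) ler_pdivrMr. Qed.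

Lemma norm1_ray x s u : 0 <= s -> norm1 u <= 1 -> norm1 (x + s *: u - x) <= s.
Proof.
by move=> s0 u1; rewrite [_ - x]addrC addKr norm1Z ger0_norm // ler_piMr.
Qed.

(** Since [c * t <= eta / 2] up to [3 * s0], dividing the hypothesis by [s'] shows that [W] is
    locally nondecreasing between [s0 / 2] and [3 * s0]. Comparing [s0] with [2 * s0] forces [a] or
    [v] to move: a combination of their increments is at least [c * s0 = eta / 6]. Closeness to the
    limits allows only [2 * (L + 3) * eta'], which is [2 * eta / 13]; hence the constant 13. *)
Lemma drop_no_limit (a v : R -> R) (L eta ra la lv : R) :
  0 <= L -> 0 < eta -> 0 < ra ->
  (forall e, 0 < e -> exists2 d, 0 < d & forall t, 0 < t < d -> `|a t - la| <= e) ->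
  (forall e, 0 < e -> exists2 d, 0 < d & forall t, 0 < t < d -> `|v t - lv| <= e) ->
  ~ (forall s, 0 < s < ra -> exists2 d, 0 < d &
    forall s', 0 < s' < ra -> `|s' - s| < d ->
    (s < s' -> s' * (a s' - a s) <=
      - (eta / 2) * (s' - s) + (L + 2) * (s' * (v s' - v s))) /\
    (s' < s -> s' * (a s - a s') <=
      eta / 2 * (s' - s) + (L + 2) * (s' * (v s - v s')))).
Proof.
move=> L0 eta0 ra0 hla hlv hinc.
pose eta' := eta / (13 * (L + 3)).
have L3 : 0 < 13 * (L + 3) by rewrite mulr_gt0 // ltr_wpDl.
have eta'0 : 0 < eta' by rewrite divr_gt0.
have eta'E : eta' * (13 * (L + 3)) = eta by rewrite divfK // gt_eqF.
have [da da0 hda] := hla _ eta'0; have [dv dv0 hdv] := hlv _ eta'0.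
have [s0 [s00 m1 m2 m3]] : exists s0,
    [/\ 0 < s0, 4 * s0 <= da, 4 * s0 <= dv & 4 * s0 <= ra].
  pose m := Num.min (Num.min da dv) (Num.min ra ra).
  have [n1' n2 n3 _] : [/\ m <= da, m <= dv, m <= ra & m <= ra] by exact: min4_le.
  have m0 : 0 < m by rewrite !lt_min da0 dv0 ra0.
  by exists (m / 4); clear -m0 n1' n2 n3; split; lra.
have [c c0 cE] : exists2 c, 0 < c & c * s0 = eta / 6.
  exists (eta / (6 * s0)); first by rewrite divr_gt0 // mulr_gt0.
  by field; rewrite gt_eqF.
pose W t := (L + 2) * v t - a t - c * t.
have hW : W s0 <= W (2 * s0).
  have [h1 h2 h3] : [/\ s0 / 2 < s0, s0 <= 2 * s0 & 2 * s0 < 3 * s0].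
    by clear -s00; split; lra.
  apply: (@locally_nondecreasing R W (s0 / 2) (3 * s0)) h1 h2 h3.
  move=> t /andP[t1 t2].
  have ht : 0 < t < ra by clear -t1 t2 m3 s00; lra.
  have [d d0 hd] := hinc t ht.
  have ct t' : t' < 3 * s0 -> c * t' <= eta / 2.
    move=> ht'; have : c * t' <= c * (3 * s0) by rewrite ler_pM2l // ltW.
    by clear -cE; lra.
  exists d => //; split=> t' /andP[h1 h2] h3.
    have t'0 : 0 < t' by clear -h1 ht; lra.
    have [||/(_ h1) k2 _] := hd t'.
    - by clear -t'0 h3 m3 s00; lra.
    - by rewrite ltr_norml; clear -h1 h2 d0; lra.
    have k3 : c * t' * (t' - t) <= eta / 2 * (t' - t).
      by rewrite ler_pM2r ?ct // subr_gt0.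
    by rewrite -(ler_pM2l t'0) /W; clear -k2 k3; lra.
  have t'0 : 0 < t' by clear -h3 s00; lra.
  have [||_ /(_ h2) k2] := hd t'.
  - by clear -t'0 h2 ht; lra.
  - by rewrite ltr_norml; clear -h1 h2 d0; lra.
  have k3 : eta / 2 * (t' - t) <= c * t' * (t' - t).
    by rewrite ler_nM2r ?ct ?subr_lt0 //; clear -h2 t2; lra.
  by rewrite -(ler_pM2l t'0) /W; clear -k2 k3; lra.
have k1 : `|a s0 - la| <= eta' by apply: hda; clear -s00 m1; lra.
have k2 : `|a (2 * s0) - la| <= eta' by apply: hda; clear -s00 m1; lra.
have k3 : `|v s0 - lv| <= eta' by apply: hdv; clear -s00 m2; lra.
have k4 : `|v (2 * s0) - lv| <= eta' by apply: hdv; clear -s00 m2; lra.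
have k5 : v (2 * s0) - v s0 <= 2 * eta'.
  by move: k3 k4; rewrite !ler_norml; clear; lra.
have k6 : (L + 2) * (v (2 * s0) - v s0) <= (L + 2) * (2 * eta').
  by apply: ler_wpM2l k5; clear -L0; lra.
move: k1 k2 hW; rewrite /W !ler_norml; clear -k6 cE eta'E eta0; lra.
Qed.

(* Otherwise choose a semialgebraic curve [u]: its coordinates are monotone near
   [0], so that up to signs they add up to a function [v] whose increments are
   those of [u] in 1-norm. Since [f] is differentiable along [x + s u(s)], the
   slope [a] of [f] on the segment from [x] decreases, modulo [v], by a fixed
   amount on each interval [s, 2s], although [a] and [v] have limits at [0]. *)
Lemma no_bad_curve f x L r eta : semialg_fun f -> lip_near f x L r -> 0 <= L ->
  0 < r -> 0 < eta ->
  ~ (exists2 r0, 0 < r0 & forall s, 0 < s < r0 -> exists u, exists w,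
    [/\ norm1 u <= 1, grad f (x + s *: u) w &
        eta * s < f (x + s *: u) - f x - s * dot w u]).
Proof.
move=> Hf lip L0 r0 eta0 [r1 r10 hbad].
pose P s u := exists w, norm1 u <= 1 /\ grad f (x + s *: u) w /\
  eta * s < f (x + s *: u) - f x - s * dot w u.
have [|u [su hu]] := @curve_choice R n P 1.
  by rewrite /P /grad /norm1 /dot; semialg_tac.
have {hbad}hu s : 0 < s < r1 -> P s (u s).
  move=> /hbad[v [w [h1 h2 h3]]]; apply: hu; exists v; split; last by exists w.
  by move=> i; apply: le_trans (le_coord_norm1 _ _) h1.
have u1 s : 0 < s < r1 -> norm1 (u s) <= 1 by move=> /hu[w []].
(* [p.1] is a radius of monotonicity of coordinate [i], and [p.2] is the sign that makes this
   coordinate nondecreasing. *)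
have /choice[g hg] : forall i, exists p : R * R, [/\ 0 < p.1, `|p.2| <= 1 &
    forall s s', 0 < s -> s <= s' -> s' < p.1 ->
    `|u s' 0 i - u s 0 i| = p.2 * u s' 0 i - p.2 * u s 0 i].
  move=> i; have [d d0 [h|h]] := sfun1_monotone (su i).
    exists (d, 1); split=> //=; first by rewrite normr1.
    by move=> s s' s0 ss' s'd; rewrite !mul1r ger0_norm // subr_ge0 h.
  exists (d, -1); split=> //=; first by rewrite normrN normr1.
  by move=> s s' s0 ss' s'd; rewrite !mulN1r ler0_norm ?subr_le0 ?h // opprB addrC opprK.
have [r2 r20 hr2] : exists2 r2, 0 < r2 & forall i, r2 <= (g i).1.
  by apply: finite_min => i; case: (hg i).
pose v s := \sum_i (g i).2 * u s 0 i.
pose a s := (f (x + s *: u s) - f x) / s.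
have sv : sfun1 v.
  by apply: sfun_sum => i; apply: sfun_mul; [exact: sfun_const|exact: su].
have sa : sfun1 a.
  apply: sfun_mul; last by apply: sfun_inv; exact: sfun_var.
  apply: sfun_add; last exact: sfun_const.
  apply: Hf => i.
  apply: (sfun_ext (g := fun e => x 0 i + e`_0 * u e`_0 0 i)).
    by move=> e; rewrite !mxE.
  apply: sfun_add; first exact: sfun_const.
  by apply: sfun_mul; [exact: sfun_var|exact: su].
have vinc s s' : 0 < s -> s <= s' -> s' < r2 -> norm1 (u s' - u s) = v s' - v s.
  move=> s0 ss' s'r; rewrite -sumrB; apply: eq_bigr => i _; rewrite !mxE.
  by case: (hg i) => _ _; apply => //; apply: lt_le_trans (hr2 i).
pose ra := Num.min r r1.
have ra0 : 0 < ra by rewrite lt_min r0.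
have [rar rar1] : ra <= r /\ ra <= r1 by rewrite !ge_min !lexx orbT.
have aL s : 0 < s < ra -> `|a s| <= L.
  move=> /andP[s0 sr].
  have us1 : norm1 (u s) <= 1 by apply: u1; lra.
  rewrite ler_norm_div //.
  apply: le_trans (lip _ x _ _) _.
  - by apply: le_trans (norm1_ray _ (ltW s0) us1) _; lra.
  - by rewrite subrr norm10 ltW.
  - by apply: ler_wpM2l => //; exact: (norm1_ray _ (ltW s0) us1).
have v1 s : 0 < s < ra -> `|v s| <= 1.
  move=> /andP[s0 sr]; apply: le_trans (u1 s _); last by lra.
  apply: le_trans (ler_norm_sum _ _ _) _; apply: ler_sum => i _.
  by case: (hg i) => _ hi _; rewrite normrM ler_piMl.
have [la hla] := sfun1_limit ra0 sa aL.
have [lv hlv] := sfun1_limit ra0 sv v1.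
pose rb := Num.min ra r2.
have rb0 : 0 < rb by rewrite lt_min ra0.
have [rbra rbr2] : rb <= ra /\ rb <= r2 by rewrite ge_min lexx ge_min lexx orbT.
apply: (drop_no_limit L0 eta0 rb0 hla hlv) => s /andP[s0 srb].
have sr : 0 < s < r by rewrite s0; clear -srb rbra rar; lra.
have [|w [us1 [gw hw]]] := hu s; first by rewrite s0; clear -srb rbra rar1; lra.
have [d d0 hd] := increment lip L0 eta0 sr us1 gw hw.
exists d => // s' /andP[s'0 s'rb] ds'.
have us'1 : norm1 (u s') <= 1 by apply: u1; rewrite s'0; clear -s'rb rbra rar1; lra.
have [hd1 hd2] := hd s' (u s') s'0 ds' us'1.
split=> hs.
  rewrite -vinc //; [|exact: ltW|exact: lt_le_trans rbr2].
  by apply: hd1; rewrite subr_gt0.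
rewrite -vinc //; [|exact: ltW|exact: lt_le_trans rbr2].
by rewrite -norm1N opprB; apply: hd2; rewrite subr_lt0.
Qed.

Lemma semialg_fun_opp f : semialg_fun f -> semialg_fun (fun y => - f y).
Proof. by move=> Hf v sv; apply: sfun_opp; apply: Hf. Qed.

Lemma lip_near_opp f x L r : lip_near f x L r -> lip_near (fun y => - f y) x L r.
Proof. by move=> lip y z hy hz; rewrite -opprD normrN; apply: lip. Qed.

Lemma grad_opp f y w : grad f y w -> grad (fun y => - f y) y (- w).
Proof.
move=> gw c /gw[d [d0 hd]]; exists d; split=> // h /hd.
by rewrite dotNl -!opprD normrN.
Qed.

(** By [germ], bad points exist at every small scale [s] or at none, and [no_bad_curve] excludes the
    former. Directions range over the whole unit ball, so that a point at distance at most [s] can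
    be rescaled by [s]. *)
Lemma grad_error_one_sided f x L r eta : semialg_fun f -> lip_near f x L r -> 0 <= L ->
  0 < r -> 0 < eta ->
  exists2 r0, 0 < r0 & forall s y w, 0 < s < r0 -> norm1 (y - x) <= s ->
    grad f y w -> f y - f x - dot w (y - x) <= eta * s.
Proof.
move=> Hf lip L0 r0 eta0.
pose B (s : R) := exists u, exists w, norm1 u <= 1 /\ (grad f (x + s *: u) w /\
    eta * s < f (x + s *: u) - f x - s * dot w u).
have [|r1 r10 [hB|hB]] := @germ R B.
- by rewrite /B /grad /norm1 /dot; semialg_tac.
- case: (no_bad_curve Hf lip L0 r0 eta0); exists r1 => // s /hB[u [w [h1 [h2 h3]]]].
  by exists u, w.
exists r1 => // s y w sr ys gw; rewrite leNgt; apply/negP => hlt.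
have s0 : 0 < s by case/andP: sr.
have yE : x + s *: (s^-1 *: (y - x)) = y.
  by rewrite scalerA mulfV ?gt_eqF // scale1r addrC subrK.
apply: (hB s sr); exists (s^-1 *: (y - x)), w; rewrite yE; split; last split => //.
  by rewrite norm1Z gtr0_norm ?invr_gt0 // mulrC ler_pdivrMr // mul1r.
by rewrite dotZr mulrA mulfV ?gt_eqF // mul1r.
Qed.

Lemma grad_error f x L r eta : semialg_fun f -> lip_near f x L r -> 0 <= L ->
  0 < r -> 0 < eta ->
  exists2 r0, 0 < r0 & forall s y w, 0 < s < r0 -> norm1 (y - x) <= s ->
    grad f y w -> `|f y - f x - dot w (y - x)| <= eta * s.
Proof.
move=> Hf lip L0 r0 eta0.
have [r1 r10 h1] := grad_error_one_sided Hf lip L0 r0 eta0.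
have [r2 r20 h2] := grad_error_one_sided (semialg_fun_opp Hf) (lip_near_opp lip) L0 r0 eta0.
exists (Num.min r1 r2) => [|s y w]; first by rewrite lt_min r10.
rewrite lt_min => /and3P[s0 sr1 sr2] ys gw.
have k1 := h1 s y w; rewrite s0 sr1 in k1; have {}k1 := k1 isT ys gw.
have k2 := h2 s y (- w); rewrite s0 sr2 in k2; have := k2 isT ys (grad_opp gw).
by rewrite dotNl ler_norml; lra.
Qed.

Lemma dird_exists f x L r h : semialg_fun f -> lip_near f x L r -> 0 < r ->
  exists l, dird f x h l.
Proof.
move=> Hf lip r0; pose q t := (f (x + t *: h) - f x) / t.
have sq : sfun1 q by rewrite /q /sfun1; semialg_tac.
have d0 : 0 < r / (norm1 h + 1) by rewrite divr_gt0 // ltr_wpDl // norm1_ge0.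
have [|l hl] := @sfun1_limit R q (r / (norm1 h + 1)) (L * norm1 h) d0 sq.
  move=> t; rewrite ltr_pdivlMr ?ltr_wpDl ?norm1_ge0 // => /andP[t0 tr].
  rewrite ler_norm_div //.
  apply: le_trans (lip _ x _ _) _.
  - rewrite [_ - x]addrC addKr norm1Z gtr0_norm //; lra.
  - by rewrite subrr norm10 ltW.
  - by rewrite [_ - x]addrC addKr norm1Z gtr0_norm // mulrCA mulrC.
exists l => c /hl[d d1 hd]; exists d; split=> // t td; have t0 : 0 < t by case/andP: td.
have := hd t td; rewrite -[q t - l](@mulfK _ t) ?gt_eqF // ler_norm_div //.
by rewrite mulrBl /q divfK ?gt_eqF // (mulrC l).
Qed.

Lemma dird_lip f x L r h h' l l' : lip_near f x L r -> 0 < r ->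
  dird f x h l -> dird f x h' l' -> `|l - l'| <= L * norm1 (h - h').
Proof.
move=> lip r0 hl hl'; apply/ler_addgt0Pr => e e0.
have e20 : 0 < e / 2 by lra.
have [d [d0 hd]] := hl _ e20; have [d' [d'0 hd']] := hl' _ e20.
have N0 : 0 < norm1 h + norm1 h' + 1 by have := norm1_ge0 h; have := norm1_ge0 h'; lra.
pose m := Num.min (Num.min d d') (r / (norm1 h + norm1 h' + 1)).
pose t := m / 2.
have m0 : 0 < m by rewrite !lt_min d0 d'0 divr_gt0.
have [m1 m2 m3] : [/\ m <= d, m <= d' & m <= r / (norm1 h + norm1 h' + 1)].
  by rewrite /m !ge_min !lexx !orbT.
have t0 : 0 < t by rewrite /t; lra.
have k1 : `|f (x + t *: h) - f x - t * l| <= e / 2 * t by apply: hd; rewrite /t; lra.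
have k2 : `|f (x + t *: h') - f x - t * l'| <= e / 2 * t by apply: hd'; rewrite /t; lra.
have hN (k : 'rV[R]_n) : norm1 k <= norm1 h + norm1 h' + 1 -> norm1 (x + t *: k - x) <= r.
  move=> hk; rewrite [_ - x]addrC addKr norm1Z gtr0_norm //.
  apply: (@le_trans _ _ (m * (norm1 h + norm1 h' + 1))).
    by apply: ler_pM => //; rewrite ?norm1_ge0 ?ltW //= /t; lra.
  by rewrite -ler_pdivlMr.
have k3 : `|f (x + t *: h) - f (x + t *: h')| <= L * norm1 (h - h') * t.
  apply: le_trans (lip _ _ _ _) _.
  - by apply: hN; have := norm1_ge0 h'; lra.
  - by apply: hN; have := norm1_ge0 h; lra.
  - by rewrite opprD addrACA subrr add0r -scalerBr norm1Z gtr0_norm // mulrCA mulrC.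
rewrite -[l - l'](@mulfK _ t) ?gt_eqF // ler_norm_div //.
by move: k1 k2 k3; rewrite !ler_norml; lra.
Qed.

Lemma dird_scale f x h l s : 0 < s -> dird f x (s *: h) l -> dird f x h (l / s).
Proof.
move=> s0 hl c c0; have [|d [d0 hd]] := hl (c * s); first exact: mulr_gt0.
exists (d * s); split=> [|t /andP[t0 td]]; first exact: mulr_gt0.
have := hd (t / s); rewrite divr_gt0 // ltr_pdivrMr // td => /(_ isT).
rewrite scalerA divfK ?gt_eqF // -mulrA [s^-1 * l]mulrC.
by rewrite -(mulrA c) [s * _]mulrC divfK ?gt_eqF.
Qed.

(** Otherwise a semialgebraic curve of bad directions [u s] exists and converges to some [v0]. Both
    [f] on the rays from [x] and the directional derivative are Lipschitz in the direction, so the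
    error along [u s] is close to the one along the fixed direction [v0], which is [o(s)]. *)
Lemma dird_error f x L r eta : semialg_fun f -> lip_near f x L r -> 0 <= L ->
  0 < r -> 0 < eta ->
  exists2 r0, 0 < r0 & forall s h l, 0 < s < r0 -> norm1 h <= s ->
    dird f x h l -> `|f (x + h) - f x - l| <= eta * s.
Proof.
move=> Hf lip L0 r0 eta0.
pose P (s : R) u := exists m : R, norm1 u <= 1 /\ (dird f x u m /\
    eta * s < `|f (x + s *: u) - f x - s * m|).
pose B (s : R) := exists u, P s u.
have [|r1 r10 [hB|hB]] := @germ R B.
- by rewrite /B /P /dird /norm1; semialg_tac.
- have [|u [su hu]] := @curve_choice R n P 1.
    by rewrite /P /dird /norm1; semialg_tac.
  have {}hu s : 0 < s < r1 -> P s (u s).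
    move=> /hB[v [m [v1 hm]]]; apply: hu; exists v; split; last by exists m.
    by move=> i; apply: le_trans (le_coord_norm1 _ _) v1.
  have /choice[u0 hu0] : forall i, exists l, forall e, 0 < e -> exists2 d, 0 < d &
      forall t, 0 < t < d -> `|u t 0 i - l| <= e.
    move=> i; apply: (@sfun1_limit R _ r1 1 r10 (su i)) => t /hu[m [u1 _]].
    by apply: le_trans (le_coord_norm1 _ _) u1.
  pose v0 := \row_i u0 i.
  have [m0 hm0] := dird_exists v0 Hf lip r0.
  have v0lim e : 0 < e -> exists2 d, 0 < d & forall t, 0 < t < d -> norm1 (u t - v0) <= e.
    (* The successor covers dimension 0, where dividing by [n] would fail. *)
    move=> e0; have [c c0 cE] : exists2 c, 0 < c & c * n.+1%:R = e.
      by exists (e / n.+1%:R); [rewrite divr_gt0|rewrite divfK].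
    have /choice[d hd] i : exists d, 0 < d /\ forall t, 0 < t < d -> `|u t 0 i - u0 i| <= c.
      by have [d d0 hd] := hu0 i _ c0; exists d.
    have [d' d'0 hd'] : exists2 r2, 0 < r2 & forall i, r2 <= d i.
      by apply: finite_min => i; case: (hd i).
    exists d' => // t /andP[t0 td].
    apply: (@le_trans _ _ (\sum_(i < n) c)).
      apply: ler_sum => i _; rewrite !mxE; case: (hd i) => _; apply.
      by rewrite t0 (lt_le_trans td).
    by rewrite sumr_const card_ord -[leLHS]mulr_natr -cE ler_pM2l // ler_nat.
  (* The three comparisons below cost [L e s], [e s] and [L e s], together less than [eta s]. *)
  pose e := eta / (2 * L + 4).
  have e0 : 0 < e by rewrite divr_gt0 //; lra.
  have eE : e * (2 * L + 4) = eta by rewrite divfK // gt_eqF //; lra.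
  have [d d0 hd] := v0lim _ e0.
  have [d' [d'0 hd']] := hm0 _ e0.
  have N0 : 0 < norm1 v0 + 1 by have := norm1_ge0 v0; lra.
  pose m := Num.min (Num.min d d') (Num.min r1 (r / (norm1 v0 + 1))).
  have [m1 m2 m3 m4] : [/\ m <= d, m <= d', m <= r1 & m <= r / (norm1 v0 + 1)].
    by rewrite /m !ge_min !lexx !orbT.
  have mp : 0 < m by rewrite !lt_min d0 d'0 r10 divr_gt0.
  pose s := m / 2.
  have s0 : 0 < s by rewrite /s; lra.
  have [|l [us1 [hl]]] := hu s; first by rewrite /s; lra.
  rewrite ltNge => /negP[].
  have k1 : norm1 (u s - v0) <= e by apply: hd; rewrite /s; lra.
  have k2 : `|f (x + s *: v0) - f x - s * m0| <= e * s by apply: hd'; rewrite /s; lra.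
  have k3 := dird_lip lip r0 hl hm0.
  have mr : m * (norm1 v0 + 1) <= r by rewrite -ler_pdivlMr.
  have mv : 0 <= m * norm1 v0 by rewrite mulr_ge0 ?norm1_ge0 // ltW.
  have k4 : `|f (x + s *: u s) - f (x + s *: v0)| <= L * norm1 (u s - v0) * s.
    apply: le_trans (lip _ _ _ _) _.
    - by apply: le_trans (norm1_ray _ (ltW s0) us1) _; rewrite /s; lra.
    - by rewrite [_ - x]addrC addKr norm1Z gtr0_norm // /s; lra.
    - by rewrite opprD addrACA subrr add0r -scalerBr norm1Z gtr0_norm // mulrCA mulrC.
  have k5 : L * norm1 (u s - v0) * s <= L * e * s.
    by rewrite ler_pM2r // ler_wpM2l.
  have k6 : `|s * l - s * m0| <= L * e * s.
    rewrite -mulrBr normrM gtr0_norm // mulrC ler_pM2r //.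
    by apply: le_trans k3 _; rewrite ler_wpM2l.
  by move: k2 k4 k6; rewrite -eE !ler_norml; lra.
exists r1 => // s h l sr hs hl; rewrite leNgt; apply/negP => hlt.
have s0 : 0 < s by case/andP: sr.
have hE : s *: (s^-1 *: h) = h by rewrite scalerA mulfV ?gt_eqF // scale1r.
apply: (hB s sr); exists (s^-1 *: h), (l / s); split; last split.
- by rewrite norm1Z gtr0_norm ?invr_gt0 // mulrC ler_pdivrMr // mul1r.
- by apply: dird_scale => //; rewrite hE.
- by rewrite hE [s * (l / s)]mulrC divfK ?gt_eqF.
Qed.

End Qualitative.

(** * Power rates with exponents independent of the point *)

Section Rates.
Variables (R : realType) (n : nat).
Implicit Types (f : 'rV[R]_n -> R) (x y h w : 'rV[R]_n).

(** [P] relates a distance [t], a relative error [s] attained within it, and the coordinates of [x]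
    as parameters, so that [d] is fixed before [x]. The conclusion is [(E / t) ^+ d <= C * t] for
    the absolute error [E], with denominators cleared. *)
Lemma grad_error_pow f : semialg_fun f -> exists d, (0 < d)%N /\ forall x L r,
  lip_near f x L r -> 0 <= L -> 0 < r ->
  exists r0 C, [/\ 0 < r0, 0 <= C & forall y w, norm1 (y - x) < r0 -> grad f y w ->
    `|f y - f x - dot w (y - x)| ^+ d <= C * norm1 (y - x) ^+ d.+1].
Proof.
move=> Hf.
pose P e := exists y, exists w, norm1 (y - \row_i e`_i.+2) <= e`_0 /\ (grad f y w /\
  e`_1 * e`_0 = `|f y - f (\row_i e`_i.+2) - dot w (y - \row_i e`_i.+2)|).
have [|d [d0 hd]] := @lojasiewicz R P.
  by rewrite /P /grad /norm1 /dot; semialg_tac.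
exists d; split=> // x L r lip L0 r0.
have [l _ lx] := row_of_seq x.
have Pl t s : P [:: t, s & l] <-> exists y, exists w, norm1 (y - x) <= t /\ (grad f y w /\
  s * t = `|f y - f x - dot w (y - x)|) by rewrite /P /= lx.
have [|r1 [C [r10 C0 hC]]] := hd l.
  move=> eta eta0; have [r1 r10 h1] := grad_error Hf lip L0 r0 eta0.
  exists r1 => // t s tr s0 /Pl[y [w [hy [gw hs]]]].
  have t0 : 0 < t by case/andP: tr.
  by rewrite -(ler_pM2r t0) hs; apply: h1.
exists r1, C; split=> // y w yr gw.
have [y0|yn0] := eqVneq (norm1 (y - x)) 0.
  have /eqP := norm1_eq0 y0; rewrite subr_eq0 => /eqP ->.
  by rewrite !subrr dot0r subr0 normr0 expr0n gtn_eqF // mulr_ge0 // exprn_ge0 // norm1_ge0.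
have t0 : 0 < norm1 (y - x) by rewrite lt_neqAle eq_sym yn0 norm1_ge0.
set t := norm1 (y - x) in t0 yr *; set E := `|_|.
have [E0|En0] := eqVneq E 0.
  by rewrite E0 expr0n gtn_eqF // mulr_ge0 // exprn_ge0 // ltW.
have s0 : 0 < E / t by rewrite divr_gt0 // lt_neqAle eq_sym En0 normr_ge0.
have := hC t (E / t); rewrite t0 yr s0 => /(_ isT isT)h.
have /h : P [:: t, E / t & l].
  by apply/Pl; exists y, w; rewrite divfK // gt_eqF.
by rewrite expr_div_n ler_pdivrMr ?exprn_gt0 // -mulrA -exprS.
Qed.

Lemma dird_error_pow f : semialg_fun f -> exists d, (0 < d)%N /\ forall x L r,
  lip_near f x L r -> 0 <= L -> 0 < r ->
  exists r0 C, [/\ 0 < r0, 0 <= C & forall h l, norm1 h < r0 -> dird f x h l ->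
    `|f (x + h) - f x - l| ^+ d <= C * norm1 h ^+ d.+1].
Proof.
move=> Hf.
pose P e := exists h, exists l : R, norm1 h <= e`_0 /\
  (dird f (\row_i e`_i.+2) h l /\
   e`_1 * e`_0 = `|f (\row_i e`_i.+2 + h) - f (\row_i e`_i.+2) - l|).
have [|d [d0 hd]] := @lojasiewicz R P.
  by rewrite /P /dird /norm1; semialg_tac.
exists d; split=> // x L r lip L0 r0.
have [xs _ xE] := row_of_seq x.
have Pl t s : P [:: t, s & xs] <-> exists h, exists l : R, norm1 h <= t /\
  (dird f x h l /\ s * t = `|f (x + h) - f x - l|) by rewrite /P /= xE.
have [|r1 [C [r10 C0 hC]]] := hd xs.
  move=> eta eta0; have [r1 r10 h1] := dird_error Hf lip L0 r0 eta0.
  exists r1 => // t s tr s0 /Pl[h [l [hh [gl hs]]]].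
  have t0 : 0 < t by case/andP: tr.
  by rewrite -(ler_pM2r t0) hs; apply: h1.
exists r1, C; split=> // h l hr hl.
have [h0|hn0] := eqVneq (norm1 h) 0.
  have h00 := norm1_eq0 h0; rewrite h00 in hl *.
  (* Along the direction 0 the definition reads [t |l| <= c t], which fails for [c = |l| / 2] unless
     [l] is 0. *)
  have l0 : l = 0.
    apply: contrapT => /eqP l0; have [|d1 [d10 hd1]] := hl (`|l| / 2).
      by rewrite divr_gt0 // normr_gt0.
    have nl : 0 < `|l| by rewrite normr_gt0.
    have hk : 0 < d1 / 2 < d1 by clear -d10; lra.
    have := hd1 _ hk; case/andP: hk => d12 _.
    rewrite scaler0 addr0 subrr sub0r normrN normrM (gtr0_norm d12).
    by rewrite mulrC ler_pM2r //; clear -nl; lra.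
  by rewrite l0 addr0 !subrr normr0 expr0n gtn_eqF // mulr_ge0 // exprn_ge0 // norm1_ge0.
have t0 : 0 < norm1 h by rewrite lt_neqAle eq_sym hn0 norm1_ge0.
set t := norm1 h in t0 hr *; set E := `|_|.
have [E0|En0] := eqVneq E 0.
  by rewrite E0 expr0n gtn_eqF // mulr_ge0 // exprn_ge0 // ltW.
have s0 : 0 < E / t by rewrite divr_gt0 // lt_neqAle eq_sym En0 normr_ge0.
have := hC t (E / t); rewrite t0 hr s0 => /(_ isT isT)hE.
have /hE : P [:: t, E / t & xs].
  by apply/Pl; exists h, l; rewrite divfK // gt_eqF.
by rewrite expr_div_n ler_pdivrMr ?exprn_gt0 // -mulrA -exprS.
Qed.

(** Because [t <= 1], the exponent may be lowered to any positive [g] up to [1 / d]; this lets a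
    single [g] serve all components. *)
Lemma root_le (d : nat) (E C t g : R) : (0 < d)%N -> 0 <= E -> 0 <= C ->
  0 <= t <= 1 -> g <= d%:R^-1 -> 0 < g -> E ^+ d <= C * t ^+ d.+1 ->
  E <= C `^ d%:R^-1 * t `^ (1 + g).
Proof.
move=> d0 E0 C0 /andP[t0 t1] gd g0 hE.
have dn0 : d%:R != 0 :> R by rewrite pnatr_eq0 -lt0n.
have [t00|tn0] := eqVneq t 0.
  move: hE; rewrite t00 expr0n /= mulr0 => hE.
  by rewrite powR0 ?mulr0 ?gt_eqF ?addr_gt0 // -(@ler_pXn2r _ d) ?nnegrE // expr0n gtn_eqF.
have {tn0}tp : 0 < t by rewrite lt_neqAle eq_sym tn0.
apply: (@le_trans _ _ (C `^ d%:R^-1 * t `^ (1 + d%:R^-1))); last first.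
  apply: ler_wpM2l; first exact: powR_ge0.
  by apply: ger_powR; rewrite ?tp // lerD2l.
rewrite -(@ler_pXn2r _ d) ?nnegrE // ?mulr_ge0 ?powR_ge0 //.
rewrite exprMn -!powR_mulrn ?powR_ge0 // -!powRrM mulVf // powRr1 // powR_mulrn //.
have -> : (1 + d%:R^-1) * d%:R = d.+1%:R :> R by rewrite mulrDl mul1r mulVf // natr1.
by rewrite powR_mulrn.
Qed.

Definition grad_rate f (g : R) := forall x L r,
  lip_near f x L r -> 0 <= L -> 0 < r ->
  exists r0 C, [/\ 0 < r0, 0 <= C & forall y w, norm1 (y - x) < r0 -> grad f y w ->
    `|f y - f x - dot w (y - x)| <= C * norm1 (y - x) `^ (1 + g)].

Definition dird_rate f (g : R) := forall x L r,
  lip_near f x L r -> 0 <= L -> 0 < r ->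
  exists r0 C, [/\ 0 < r0, 0 <= C & forall h l, norm1 h < r0 -> dird f x h l ->
    `|f (x + h) - f x - l| <= C * norm1 h `^ (1 + g)].

Lemma grad_error_rate f : semialg_fun f ->
  exists g0, 0 < g0 /\ forall g, 0 < g <= g0 -> grad_rate f g.
Proof.
move=> /grad_error_pow[d [d0 hd]].
exists d%:R^-1; split=> [|g /andP[g0 gd] x L r lip L0 r0].
  by rewrite invr_gt0 ltr0n.
have [r1 [C [r10 C0 h]]] := hd x L r lip L0 r0.
exists (Num.min 1 r1), (C `^ d%:R^-1); split; rewrite ?lt_min ?ltr01 ?powR_ge0 //.
move=> y w; rewrite lt_min => /andP[y1 yr] gw.
by apply: root_le gd g0 (h y w yr gw) => //; rewrite norm1_ge0 ltW.
Qed.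

Lemma dird_error_rate f : semialg_fun f ->
  exists g0, 0 < g0 /\ forall g, 0 < g <= g0 -> dird_rate f g.
Proof.
move=> /dird_error_pow[d [d0 hd]].
exists d%:R^-1; split=> [|g /andP[g0 gd] x L r lip L0 r0].
  by rewrite invr_gt0 ltr0n.
have [r1 [C [r10 C0 h]]] := hd x L r lip L0 r0.
exists (Num.min 1 r1), (C `^ d%:R^-1); split; rewrite ?lt_min ?ltr01 ?powR_ge0 //.
move=> k l; rewrite lt_min => /andP[y1 yr] gw.
by apply: root_le gd g0 (h k l yr gw) => //; rewrite norm1_ge0 ltW.
Qed.

End Rates.

(** * Semismoothness *)

Section InnerProduct.
Variables (R : realType) (m n : nat).
Implicit Types X Y Z : 'M[R]_(m, n).

Lemma mxdotC X Y : mxdot X Y = mxdot Y X.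
Proof. by apply: eq_bigr => i _; apply: eq_bigr => j _; rewrite mulrC. Qed.

Lemma mxdotDl X Y Z : mxdot (X + Y) Z = mxdot X Z + mxdot Y Z.
Proof.
rewrite -big_split; apply: eq_bigr => i _; rewrite -big_split.
by apply: eq_bigr => j _; rewrite mxE mulrDl.
Qed.

Lemma mxdotZl (a : R) X Y : mxdot (a *: X) Y = a * mxdot X Y.
Proof.
rewrite mulr_sumr; apply: eq_bigr => i _; rewrite mulr_sumr.
by apply: eq_bigr => j _; rewrite mxE mulrA.
Qed.

Lemma mxdotNl X Y : mxdot (- X) Y = - mxdot X Y.
Proof. by rewrite -scaleN1r mxdotZl mulN1r. Qed.

Lemma mxdotDr X Y Z : mxdot X (Y + Z) = mxdot X Y + mxdot X Z.
Proof. by rewrite mxdotC mxdotDl !(mxdotC X). Qed.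

Lemma mxdotZr (a : R) X Y : mxdot X (a *: Y) = a * mxdot X Y.
Proof. by rewrite mxdotC mxdotZl mxdotC. Qed.

Lemma mxdotNr X Y : mxdot X (- Y) = - mxdot X Y.
Proof. by rewrite mxdotC mxdotNl mxdotC. Qed.

Lemma mxdot_ge0 X : 0 <= mxdot X X.
Proof. by apply: sumr_ge0 => i _; apply: sumr_ge0 => j _; rewrite -expr2 sqr_ge0. Qed.

Lemma le_coord_enorm X i j : `|X i j| <= enorm X.
Proof.
rewrite -sqrtr_sqr ler_wsqrtr // /mxdot (bigD1 i) //= (bigD1 j) //= -addrA expr2 lerDl.
by rewrite addr_ge0 //; apply: sumr_ge0 => k _;
  [|apply: sumr_ge0 => l _]; rewrite -expr2 sqr_ge0.
Qed.

Lemma enorm_sqr X : enorm X ^+ 2 = mxdot X X.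
Proof. by rewrite sqr_sqrtr ?mxdot_ge0. Qed.

Lemma enorm_ge0 X : 0 <= enorm X.
Proof. exact: sqrtr_ge0. Qed.

Lemma enorm_eq0 X : enorm X = 0 -> X = 0.
Proof.
move=> X0; apply/matrixP => i j; rewrite mxE; apply/eqP.
by rewrite -normr_le0 -X0 le_coord_enorm.
Qed.

Lemma enorm0 : enorm (0 : 'M[R]_(m, n)) = 0.
Proof. by rewrite /enorm -(scale0r 0) mxdotZl mul0r sqrtr0. Qed.

Lemma enormZ (a : R) X : enorm (a *: X) = `|a| * enorm X.
Proof. by rewrite /enorm mxdotZl mxdotZr mulrA -expr2 sqrtrM ?sqr_ge0 // sqrtr_sqr. Qed.

Lemma enormN X : enorm (- X) = enorm X.
Proof. by rewrite -scaleN1r enormZ normrN1 mul1r. Qed.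

Lemma ler_enorm X Y : (enorm X <= enorm Y) = (mxdot X X <= mxdot Y Y).
Proof. by rewrite ler_sqrt ?mxdot_ge0. Qed.

Lemma mxdot_subZ (t : R) X Y : mxdot (X - t *: Y) (X - t *: Y) =
  mxdot X X - 2 * t * mxdot X Y + t * t * mxdot Y Y.
Proof.
rewrite mxdotDl !mxdotDr !mxdotNl !mxdotNr !mxdotZl !mxdotZr (mxdotC Y X).
by ring.
Qed.

Lemma cauchy_schwarz X Y : mxdot X Y <= enorm X * enorm Y.
Proof.
have [X0|Xn0] := eqVneq (enorm X) 0.
  by rewrite X0 mul0r (enorm_eq0 X0) -(scale0r 0) mxdotZl mul0r.
have [Y0|Yn0] := eqVneq (enorm Y) 0.
  by rewrite Y0 mulr0 (enorm_eq0 Y0) -(scale0r 0) mxdotZr mul0r.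
have Xp : 0 < enorm X by rewrite lt_neqAle eq_sym Xn0 sqrtr_ge0.
have Yp : 0 < enorm Y by rewrite lt_neqAle eq_sym Yn0 sqrtr_ge0.
have := mxdot_ge0 (enorm Y *: X - enorm X *: Y).
rewrite mxdotDl !mxdotDr !mxdotNl !mxdotNr !mxdotZl !mxdotZr (mxdotC Y X) -!enorm_sqr.
set a := enorm X in Xp *; set b := enorm Y in Yp *; set c := mxdot X Y => h.
rewrite -subr_ge0 -(pmulr_rge0 _ (mulr_gt0 Xp Yp)).
by clear -h; lra.
Qed.

Lemma ler_enormD X Y : enorm (X + Y) <= enorm X + enorm Y.
Proof.
rewrite -(@ler_pXn2r _ 2) ?nnegrE ?addr_ge0 ?sqrtr_ge0 //.
rewrite enorm_sqr mxdotDl !mxdotDr (mxdotC Y X) sqrrD !enorm_sqr.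
by have := cauchy_schwarz X Y; clear; lra.
Qed.

Lemma ler_dist_enorm X Y : `|enorm X - enorm Y| <= enorm (X - Y).
Proof.
have h1 := ler_enormD (X - Y) Y; have h2 := ler_enormD (Y - X) X.
rewrite subrK in h1; rewrite subrK -(enormN (Y - X)) opprB in h2.
by rewrite ler_norml; clear -h1 h2; lra.
Qed.

End InnerProduct.

(** * Comparison of the Euclidean, maximum and 1-norms *)

Section NormComparison.
Variables (R : realType) (n : nat).
Implicit Types (v w x : 'rV[R]_n).

Lemma enorm_rowE v : enorm v = Num.sqrt (\sum_i v 0 i ^+ 2).
Proof.
by rewrite /enorm /mxdot big_ord1; congr Num.sqrt; apply: eq_bigr => i _; rewrite expr2.
Qed.

Lemma norm1_le_enorm v : norm1 v <= n%:R * enorm v.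
Proof.
apply: (@le_trans _ _ (\sum_(i < n) enorm v)).
  by apply: ler_sum => i _; apply: le_coord_enorm.
by rewrite sumr_const card_ord mulr_natl.
Qed.

Lemma enorm_le_norm1 v : enorm v <= norm1 v.
Proof.
rewrite enorm_rowE -(ger0_norm (norm1_ge0 v)) -sqrtr_sqr ler_wsqrtr //.
rewrite expr2 {1}/norm1 mulr_suml.
apply: ler_sum => i _; rewrite -[v 0 i ^+ 2]real_normK ?num_real // expr2 ler_wpM2l //.
exact: le_coord_norm1.
Qed.

Lemma le_coord_norm v i : `|v 0 i| <= `|v|.
Proof.
rewrite /Num.Def.normr /= mx_normrE.
exact: (le_bigmax _ (fun ij : 'I_1 * 'I_n => `|v ij.1 ij.2|) (0, i)).
Qed.

Lemma norm_le_norm1 v : `|v| <= norm1 v.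
Proof.
rewrite /Num.Def.normr /= mx_normrE; apply: bigmax_le; first exact: norm1_ge0.
by move=> [i j] _ /=; rewrite ord1 le_coord_norm1.
Qed.

Lemma norm1_le_norm v : norm1 v <= n%:R * `|v|.
Proof.
apply: (@le_trans _ _ (\sum_(i < n) `|v|)).
  by apply: ler_sum => i _; apply: le_coord_norm.
by rewrite sumr_const card_ord mulr_natl.
Qed.

Lemma nbhs_norm1 x (U : set 'rV[R]_n) : nbhs x U ->
  exists2 r, 0 < r & forall y, norm1 (y - x) <= r -> U y.
Proof.
move=> /nbhs_normP[r /= r0 hr]; exists (r / 2) => [|y hy]; first by rewrite divr_gt0.
apply: hr; rewrite /= distrC; apply: le_lt_trans (norm_le_norm1 _) _.
by apply: le_lt_trans hy _; clear -r0; lra.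
Qed.

Lemma near_norm1 x (P : set 'rV[R]_n) r : 0 < r ->
  (forall y, norm1 (y - x) < r -> P y) -> \forall y \near x, P y.
Proof.
move=> r0 hP; apply/nbhs_normP; exists (r / n.+1%:R); first by rewrite /= divr_gt0.
move=> y; rewrite /= distrC ltr_pdivlMr // mulrC => hy; apply: hP.
apply: le_lt_trans (norm1_le_norm _) (le_lt_trans _ hy).
by rewrite ler_wpM2r // ler_nat.
Qed.

End NormComparison.

(** * From componentwise rates to semismoothness *)

Section Transfer.
Variables (R : realType) (n q : nat).
Implicit Types (F : 'rV[R]_n -> 'rV[R]_q) (x y h : 'rV[R]_n).

(** Row vectors are multiplied by the Jacobian on the right, so the gradient of component [i] is
    column [i]. *)
Lemma diff_grad F y i : differentiable F y ->
  grad (fun z => F z 0 i) y (\row_j 'J F y j i).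
Proof.
move=> dF c c0; have /eqaddoP/(_ c c0)/nbhs_norm1[r r0 hr] := diff_locally dF.
exists r; split=> // h hh; have := hr h; rewrite subr0 => /(_ hh).
rewrite /= => hb; apply: le_trans (_ : _ <= c * `|h|) _; last first.
  by rewrite ler_pM2l // norm_le_norm1.
apply: le_trans hb.
have -> : F (y + h) 0 i - F y 0 i - dot (\row_j 'J F y j i) h =
  ((F \o shift y - (cst (F y) + 'd F y)) h) 0 i.
  rewrite -[dot _ _]/(\sum_j _) !fctE /= [h + y]addrC !mxE -deriveE // deriveEjacobian //.
  rewrite !mxE opprD addrA; congr (_ - _); apply: eq_bigr => j _.
  by rewrite mxE mulrC.
exact: le_coord_norm.
Qed.

End Transfer.

Section Transfer2.
Variables (R : realType) (n q : nat).
Implicit Types (F : 'rV[R]_n -> 'rV[R]_q) (x y h : 'rV[R]_n).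

Lemma cvg_finsum (I : finType) (f : I -> nat -> R) (l : I -> R) :
  (forall i, f i k @[k --> \oo] --> l i) ->
  \sum_i f i k @[k --> \oo] --> \sum_i l i.
Proof.
move=> fl; suff h (s : seq I) : \sum_(i <- s) f i k @[k --> \oo] --> \sum_(i <- s) l i.
  exact: h.
elim: s => [|i s ih].
  rewrite big_nil; under eq_fun do rewrite big_nil; exact: cvg_cst.
by rewrite big_cons; under eq_fun do rewrite big_cons; apply: cvgD.
Qed.

Lemma local_lip_coord F x (L : R) (U : set 'rV[R]_n) : nbhs x U ->
  (forall y z, U y -> U z -> enorm (F y - F z) <= L * enorm (y - z)) ->
  exists L' r, [/\ 0 <= L', 0 < r & forall i, lip_near (fun z => F z 0 i) x L' r].
Proof.
(* The Lipschitz constant in the definition carries no sign, hence the maximum with 0. *)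
move=> /nbhs_norm1[r r0 hr] hU; exists (Num.max L 0), r; split=> //.
  by rewrite le_max lexx orbT.
move=> i y z hy hz; have := hU y z (hr _ hy) (hr _ hz).
have := le_coord_enorm (F y - F z) 0 i; rewrite !mxE => h1 h2.
apply: le_trans h1 (le_trans h2 _).
apply: (@le_trans _ _ (Num.max L 0 * enorm (y - z))).
  by rewrite ler_wpM2r ?enorm_ge0 // le_max lexx.
by rewrite ler_wpM2l ?le_max ?lexx ?orbT // enorm_le_norm1.
Qed.

Lemma pow_norm1_le g (c : R) h : 0 <= c -> 0 <= 1 + g ->
  (c * norm1 h) `^ (1 + g) <= (c * n%:R) `^ (1 + g) * enorm h `^ (1 + g).
Proof.
move=> c0 g0; rewrite -powRM ?mulr_ge0 ?enorm_ge0 // -mulrA.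
apply: ge0_ler_powR => //; rewrite ?nnegrE ?mulr_ge0 ?norm1_ge0 ?enorm_ge0 //.
by rewrite ler_wpM2l // norm1_le_enorm.
Qed.

Lemma norm1_le_coords (m : nat) (v : 'rV[R]_m) (B : R) :
  (forall i, `|v 0 i| <= B) -> norm1 v <= m%:R * B.
Proof.
move=> hB; apply: (@le_trans _ _ (\sum_(i < m) B)); first exact: ler_sum.
by rewrite sumr_const card_ord mulr_natl.
Qed.

(** The differentiability points [u k] tending to [x + h] are eventually within [2 * norm1 h] of
    [x], a bound that does not depend on [k] and survives the limit; the radius [r / 2] keeps them
    where the rate applies. *)
Lemma rate_Gsemismooth F x (L r C g : R) : 0 <= 1 + g -> 0 <= L -> 0 < r -> 0 <= C ->
  (forall i, lip_near (fun z => F z 0 i) x L r) ->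
  (forall i y w, norm1 (y - x) < r -> grad (fun z => F z 0 i) y w ->
    `|F y 0 i - F x 0 i - dot w (y - x)| <= C * norm1 (y - x) `^ (1 + g)) ->
  Gsemismooth g F x.
Proof.
move=> g0 L0 r0 C0 lip hrate.
have hB h V i : norm1 h < r / 2 -> bsubdiff F (x + h) V ->
    `|(F (x + h) - F x - h *m V) 0 i| <= C * (2 * norm1 h) `^ (1 + g).
  move=> hr [u [du cu cJ]].
  (* For [h = 0] the error vanishes; otherwise [norm1 h] is a positive tolerance for the distance
     from [u k] to [x + h]. *)
  have [h0|hn0] := eqVneq (norm1 h) 0.
    rewrite (norm1_eq0 h0) addr0 subrr mul0mx subr0 mxE normr0.
    by rewrite mulr_ge0 // powR_ge0.
  have hp : 0 < norm1 h by rewrite lt_neqAle eq_sym hn0 norm1_ge0.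
  have cu1 e : 0 < e -> \forall k \near \oo, norm1 (u k - (x + h)) <= e.
    move=> e0; have en : 0 < e / n.+1%:R by rewrite divr_gt0.
    have /cvgrPdist_le/(_ _ en) := cu; apply: filterS => k hk.
    rewrite -norm1N opprB; apply: le_trans (norm1_le_norm _) _.
    have n0 : 0 < n.+1%:R :> R by [].
    apply: (@le_trans _ _ (n.+1%:R * (e / n.+1%:R))).
      by apply: ler_pM => //; rewrite ler_nat.
    by rewrite mulrC divfK ?gt_eqF.
  have cuj j : u k 0 j @[k --> \oo] --> (x + h) 0 j.
    by apply: (cvg_comp u (fun M : 'rV[R]_n => M 0 j) cu); exact: coord_continuous.
  have cJj j : 'J F (u k) j i @[k --> \oo] --> V j i.
    apply: (cvg_comp (fun k => 'J F (u k)) (fun M : 'M[R]_(n, q) => M j i) cJ).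
    exact: coord_continuous.
  have nxh : norm1 (x + h - x) <= r by rewrite addrC addKr; clear -hr r0; lra.
  have near1 : \forall k \near \oo, norm1 (u k - x) <= 2 * norm1 h.
    have := cu1 _ hp; apply: filterS => k hk.
    rewrite (_ : u k - x = (u k - (x + h)) + h); last by rewrite opprD addrA subrK.
    by apply: le_trans (ler_norm1D _ _) _; clear -hk; lra.
  have cF : F (u k) 0 i @[k --> \oo] --> F (x + h) 0 i.
    apply/cvgrPdist_le => e e0.
    have L1 : 0 < L + 1 by clear -L0; lra.
    have e1 : 0 < e / (L + 1) by rewrite divr_gt0.
    near=> k; rewrite distrC.
    apply: le_trans (lip i (u k) (x + h) _ nxh) _.
      by apply: (@le_trans _ _ (2 * norm1 h)); [near: k|clear -hr; lra].
    apply: (@le_trans _ _ (L * (e / (L + 1)))).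
      by apply: ler_wpM2l => //; near: k; exact: cu1.
    by rewrite mulrA ler_pdivrMr // mulrDr mulr1 mulrC lerDl ltW.
  have cz : F (u k) 0 i - F x 0 i - \sum_j (u k 0 j - x 0 j) * 'J F (u k) j i
      @[k --> \oo] --> F (x + h) 0 i - F x 0 i - \sum_j ((x + h) 0 j - x 0 j) * V j i.
    apply: cvgB; first by apply: cvgB => //; exact: cvg_cst.
    apply: cvg_finsum => j; apply: cvgM => //.
    by apply: cvgB => //; exact: cvg_cst.
  have -> : (F (x + h) - F x - h *m V) 0 i =
      F (x + h) 0 i - F x 0 i - \sum_j ((x + h) 0 j - x 0 j) * V j i.
    rewrite !mxE; congr (_ - _); apply: eq_bigr => j _.
    by rewrite !mxE addrAC subrr add0r.
  apply: (ler_cvg_to (cvg_norm cz) (cvg_cst _)).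
  near=> k.
  have ukr : norm1 (u k - x) <= 2 * norm1 h by near: k.
  have := hrate i (u k) _ _ (diff_grad i (du k)).
  rewrite (_ : dot _ _ = \sum_j (u k 0 j - x 0 j) * 'J F (u k) j i); last first.
    by apply: eq_bigr => j _; rewrite !mxE mulrC.
  move=> hk; apply: le_trans (hk _) _; first by clear -ukr hr; lra.
  apply: ler_wpM2l => //; apply: ge0_ler_powR; rewrite ?nnegrE ?mulr_ge0 ?norm1_ge0 //.
exists (q%:R * (C * (2 * n%:R) `^ (1 + g))).
apply: (@near_norm1 _ _ _ _ (r / 2)) => [|h]; first by rewrite divr_gt0.
rewrite subr0 => hr V [k [w [U [w0 w1 hU ->]]]].
apply: le_trans (enorm_le_norm1 _) _.
apply: (@le_trans _ _ (q%:R * (C * (2 * norm1 h) `^ (1 + g)))); last first.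
  rewrite -!mulrA ler_wpM2l // ler_wpM2l //; exact: pow_norm1_le.
apply: norm1_le_coords => i.
(* The weights add up to 1, so the error of a convex combination is the same combination of the
   errors. *)
have -> : F (x + h) - F x - h *m (\sum_j w j *: U j) =
    \sum_j w j *: (F (x + h) - F x - h *m U j).
  under [RHS]eq_bigr do rewrite scalerBr.
  rewrite sumrB -scaler_suml w1 scale1r mulmx_sumr; congr (_ - _).
  by apply: eq_bigr => j _; rewrite scalemxAr.
rewrite summxE.
apply: le_trans (ler_norm_sum _ _ _) _.
rewrite -[leRHS]mul1r -{1}w1 mulr_suml; apply: ler_sum => j _.
rewrite [X in `|X|]mxE normrM ger0_norm // ler_wpM2l //.
exact: hB hr (hU j).
Unshelve. all: by end_near.
Qed.

Lemma rate_dirdifferentiable F x (L r C g : R) :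
  0 <= 1 + g -> 0 <= L -> 0 < r -> 0 <= C ->
  (forall i, lip_near (fun z => F z 0 i) x L r) ->
  (forall i, semialg_fun (fun z => F z 0 i)) ->
  (forall i h l, norm1 h < r -> dird (fun z => F z 0 i) x h l ->
    `|F (x + h) 0 i - F x 0 i - l| <= C * norm1 h `^ (1 + g)) ->
  dirdifferentiable g F x.
Proof.
move=> g0 L0 r0 C0 lip hF hrate.
have hdir h : exists2 l : 'rV[R]_q, (forall i, dird (fun z => F z 0 i) x h (l 0 i)) &
    dirquot F x h t @[t --> 0^'+] --> l.
  have /choice[l hl] i : exists l, dird (fun z => F z 0 i) x h l.
    exact: (dird_exists h (hF i) (lip i) r0).
  exists (\row_i l i) => [i|]; first by rewrite mxE.
  apply/cvgrPdist_le => e e0.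
  have en : 0 < e / q.+1%:R by rewrite divr_gt0.
  have /choice[d hd] i : exists d, 0 < d /\ forall t, 0 < t < d ->
      `|F (x + t *: h) 0 i - F x 0 i - t * l i| <= e / q.+1%:R * t.
    by have [d [d0 hd]] := hl i _ en; exists d.
  have [d' d'0 hd'] : exists2 d', 0 < d' & forall i, d' <= d i.
    by apply: finite_min => i; case: (hd i).
  near=> t.
  have t0 : 0 < t by near: t; exact: nbhs_right_gt.
  have td : t < d' by near: t; exact: nbhs_right_lt.
  rewrite distrC; apply: le_trans (norm_le_norm1 _) _.
  apply: (@le_trans _ _ (q%:R * (e / q.+1%:R))); last first.
    by rewrite mulrA ler_pdivrMr // mulrC ler_pM2l // ler_nat.
  apply: norm1_le_coords => i; rewrite !mxE.
  rewrite (_ : _ - l i = (F (x + t *: h) 0 i - F x 0 i - t * l i) / t).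
    by rewrite ler_norm_div //; case: (hd i) => _; apply; rewrite t0 (lt_le_trans td).
  by field; rewrite gt_eqF.
split=> [h|]; first by have [l _ hl] := hdir h; apply/cvg_ex; exists l.
exists (q%:R * (C * (1 * n%:R) `^ (1 + g))).
apply: (@near_norm1 _ _ _ _ r) => // h; rewrite subr0 => hr.
have [l hl cl] := hdir h.
have -> : dirderiv F x h = l by apply: cvg_lim cl; exact: norm_hausdorff.
apply: le_trans (enorm_le_norm1 _) _.
apply: (@le_trans _ _ (q%:R * (C * (1 * norm1 h) `^ (1 + g)))); last first.
  rewrite -!mulrA ler_wpM2l // ler_wpM2l //; exact: pow_norm1_le.
apply: norm1_le_coords => i; rewrite !mxE mul1r.
exact: hrate.
Unshelve. all: by end_near.
Qed.

(** The exponent is the least one over the components of [F], and is fixed before the open set and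
    the point; radii and constants are allowed to depend on the point. *)
Theorem semialg_semismooth F : (forall i, semialg_fun (fun z => F z 0 i)) ->
  exists2 g0, 0 < g0 & forall g, 0 < g <= g0 -> forall O, open O ->
  locally_lipschitz F O -> semismooth_on g F O.
Proof.
move=> hF.
have /choice[ga hga] i := grad_error_rate (hF i).
have /choice[gb hgb] i := dird_error_rate (hF i).
have [g1 g10 hg1] := finite_min (fun i => proj1 (hga i)).
have [g2 g20 hg2] := finite_min (fun i => proj1 (hgb i)).
exists (Num.min g1 g2) => [|g]; first by rewrite lt_min g10.
rewrite le_min => /and3P[g0 gg1 gg2] O oO lO; split=> // x Ox.
have [L0 [U [xU hU]]] := lO x Ox.
have [L [r [L0' r0 lip]]] := local_lip_coord xU hU.
have g1' : 0 <= 1 + g by rewrite addr_ge0 // ltW.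
split.
  have /choice[p hp] i : exists p : R * R, [/\ 0 < p.1, 0 <= p.2 &
      forall y w, norm1 (y - x) < p.1 -> grad (fun z => F z 0 i) y w ->
      `|F y 0 i - F x 0 i - dot w (y - x)| <= p.2 * norm1 (y - x) `^ (1 + g)].
    have [|r1 [C h]] := proj2 (hga i) g _ x L r (lip i) L0' r0.
      by rewrite g0 (le_trans gg1).
    by exists (r1, C).
  have [r1 r10 hr1] : exists2 r1, 0 < r1 & forall i, r1 <= (p i).1.
    by apply: finite_min => i; case: (hp i).
  have C0 i : 0 <= (p i).2 by case: (hp i).
  apply: (@rate_Gsemismooth F x L (Num.min r r1) (\sum_i (p i).2)) => //.
  - by rewrite lt_min r0.
  - exact: sumr_ge0.
  - by move=> i y z; rewrite !le_min => /andP[hy _] /andP[hz _]; apply: lip.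
  - move=> i y w; rewrite lt_min => /andP[_ hy] gw.
    case: (hp i) => _ _ /(_ y w (lt_le_trans hy (hr1 i)) gw) hle.
    apply: le_trans hle _; rewrite ler_wpM2r ?powR_ge0 //.
    by rewrite (bigD1 i) //= lerDl sumr_ge0.
have /choice[p hp] i : exists p : R * R, [/\ 0 < p.1, 0 <= p.2 &
    forall h l, norm1 h < p.1 -> dird (fun z => F z 0 i) x h l ->
    `|F (x + h) 0 i - F x 0 i - l| <= p.2 * norm1 h `^ (1 + g)].
  have [|r1 [C h]] := proj2 (hgb i) g _ x L r (lip i) L0' r0.
    by rewrite g0 (le_trans gg2).
  by exists (r1, C).
have [r1 r10 hr1] : exists2 r1, 0 < r1 & forall i, r1 <= (p i).1.
  by apply: finite_min => i; case: (hp i).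
have C0 i : 0 <= (p i).2 by case: (hp i).
apply: (@rate_dirdifferentiable F x L (Num.min r r1) (\sum_i (p i).2)) => //.
- by rewrite lt_min r0.
- exact: sumr_ge0.
- by move=> i y z; rewrite !le_min => /andP[hy _] /andP[hz _]; apply: lip.
- move=> i h l; rewrite lt_min => /andP[_ hy] hl.
  case: (hp i) => _ _ /(_ h l (lt_le_trans hy (hr1 i)) hl) hle.
  apply: le_trans hle _; rewrite ler_wpM2r ?powR_ge0 //.
  by rewrite (bigD1 i) //= lerDl sumr_ge0.
Qed.

End Transfer2.

(** * Projections and the value function *)

Section Projection.
Variables (R : realType) (p : nat).
Implicit Types (x y z : 'rV[R]_p).
Implicit Types Q : set 'rV[R]_p.

Definition semialg_set Q := forall v : seq R -> 'rV[R]_p,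
  (forall i, sfun (fun e => v e 0 i)) -> semialg (fun e => Q (v e)).

(** Closed convex semialgebraic sets containing 0. Boundedness is not included, since the spectral
    ball is unbounded when [Astar] has a kernel. *)
Definition convex_body Q := [/\ semialg_set Q, Q 0,
  forall y z (t : R), Q y -> Q z -> 0 <= t <= 1 -> Q (y + t *: (z - y)) &
  forall x, (forall c, 0 < c -> exists2 z, Q z & norm1 (z - x) <= c) -> Q x].

Definition is_proj Q x y := Q y /\ forall z, Q z -> enorm (x - y) <= enorm (x - z).

(* The points of [Q] within [inf + t] of [x] are selected along a semialgebraic
   curve, which has a limit as [t] tends to [0]. *)
Lemma is_proj_exists Q x : convex_body Q -> exists y, is_proj Q x y.
Proof.
move=> [Qsa Q0 _ Qclosed].
pose S := [set enorm (x - z) | z in Q].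
have hinf : has_inf S.
  by split; [exists (enorm (x - 0)), 0|exists 0 => _ [z _ <-]; apply: enorm_ge0].
have Sge z : Q z -> inf S <= enorm (x - z).
  by move=> Qz; apply: (ge_inf (proj2 hinf)); exists z.
have S0 : 0 <= inf S.
  by apply: lb_le_inf; [case: hinf|move=> _ [z _ <-]; apply: enorm_ge0].
(* A bound on the coordinates of the near-minimizers with [t < 1], as required by [curve_choice]. *)
pose K := inf S + 1 + enorm x.
(* Squaring both sides makes the distance condition polynomial. *)
pose P (t : R) z := Q z /\ mxdot (x - z) (x - z) <= (inf S + t) * (inf S + t).
have [|u [su hu]] := @curve_choice R p P K.
  apply: semialg_and.
    by apply: Qsa => i; semialg_tac.
  by rewrite /mxdot; semialg_tac.
have {}hu t : 0 < t < 1 -> Q (u t) /\ enorm (x - u t) <= inf S + t.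
  move=> /andP[t0 t1].
  have t2 : 0 <= inf S + t by rewrite addr_ge0 // ltW.
  have sq z : (enorm (x - z) <= inf S + t) =
      (mxdot (x - z) (x - z) <= (inf S + t) * (inf S + t)).
    by rewrite -expr2 -enorm_sqr ler_pXn2r ?nnegrE ?enorm_ge0.
  rewrite sq; apply: hu.
  have [_ [z Qz <-] hz] := inf_adherent t0 hinf.
  exists z; split; last by split=> //; rewrite -sq ltW.
  move=> i; apply: le_trans (le_coord_enorm _ _ _) _.
  rewrite -[z](subrKC x) (le_trans (ler_enormD _ _)) // -(enormN (z - x)) opprB.
  by rewrite /K; clear -hz t1; lra.
have /choice[l hl] i : exists l, forall c, 0 < c -> exists2 d, 0 < d &
    forall t, 0 < t < d -> `|u t 0 i - l| <= c.
  apply: (@sfun1_limit R _ 1 K ltr01 (su i)) => t ht; have [_ h] := hu t ht.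
  apply: le_trans (le_coord_enorm _ _ _) _.
  rewrite -[u t](subrKC x) (le_trans (ler_enormD _ _)) // -(enormN (u t - x)) opprB.
  by rewrite /K; case/andP: ht => _; clear -h; lra.
pose y := \row_i l i.
have ylim c : 0 < c -> exists t, [/\ 0 < t < 1, t <= c & norm1 (u t - y) <= c].
  move=> c0; have [c1 c10 cE] : exists2 c1, 0 < c1 & c1 * p.+1%:R = c.
    by exists (c / p.+1%:R); [rewrite divr_gt0|rewrite divfK].
  have /choice[d hd] i : exists d, 0 < d /\ forall t, 0 < t < d -> `|u t 0 i - l i| <= c1.
    by have [d d0 hd] := hl i _ c10; exists d.
  have [d' d'0 hd'] : exists2 d', 0 < d' & forall i, d' <= d i.
    by apply: finite_min => i; case: (hd i).
  pose m := Num.min (Num.min d' c) (Num.min 1 1).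
  have [m1 m2 m3 _] : [/\ m <= d', m <= c, m <= 1 & m <= 1] by exact: min4_le.
  have m0 : 0 < m by rewrite !lt_min d'0 c0 ltr01.
  exists (m / 2); split; [clear -m0 m3; lra|clear -m0 m2; lra|].
  apply: (@le_trans _ _ (p%:R * c1)); last first.
    by rewrite -cE mulrC ler_pM2l // ler_nat.
  apply: norm1_le_coords => i; rewrite !mxE; case: (hd i) => _; apply.
  by have := hd' i; clear -m0 m1; lra.
exists y; split.
  apply: Qclosed => c /ylim[t [ht _ hc]]; exists (u t) => //.
  by case: (hu t ht).
move=> z /Sge; apply: le_trans; apply/ler_addgt0Pr => c c0.
have c20 : 0 < c / 2 by clear -c0; lra.
have [t [ht tc hc]] := ylim _ c20; have [_ h] := hu t ht.
have := ler_enormD (x - u t) (u t - y); rewrite addrA subrK.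
by have := enorm_le_norm1 (u t - y); lra.
Qed.

(** Moving from [y] towards [z] by [t] cannot decrease the distance to [x]; expanding gives
    [2 * s <= t * D], where [t] is chosen to make [t * D <= c]. *)
Lemma is_proj_variational Q x y z : convex_body Q -> is_proj Q x y -> Q z ->
  mxdot (x - y) (z - y) <= 0.
Proof.
move=> [_ _ Qconv _] [Qy hy] Qz; apply/ler_addgt0Pr => c c0; rewrite add0r.
set D := mxdot (z - y) (z - y).
have D0 : 0 <= D by apply: mxdot_ge0.
pose t := Num.min 1 (c / (D + 1)).
have D1 : 0 < D + 1 by clear -D0; lra.
have t0 : 0 < t by rewrite lt_min ltr01 divr_gt0.
have [t1 tc] : t <= 1 /\ t <= c / (D + 1) by rewrite !ge_min !lexx orbT.
have t01 : 0 <= t <= 1 by rewrite (ltW t0) t1.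
have := hy _ (Qconv _ _ _ Qy Qz t01).
have -> : x - (y + t *: (z - y)) = (x - y) - t *: (z - y) by rewrite opprD addrA.
rewrite ler_enorm mxdot_subZ -/D; set s := mxdot _ (z - y) => h.
rewrite ler_pdivlMr // in tc.
have h2 : t * D <= c by move: (ltW t0) tc; clear; lra.
have h3 : t * (2 * s) <= t * (t * D) by clear -h; lra.
rewrite ler_pM2l // in h3; clear -h2 h3 c0; lra.
Qed.

(** Adding the two variational inequalities bounds [mxdot (y - y') (y - y')] by
    [mxdot (x - x') (y - y')]; the nonnegative square of [(x - x') - (y - y')] then replaces
    Cauchy-Schwarz. Uniqueness of the projection is the case [x = x']. *)
Lemma is_proj_nonexpansive Q x x' y y' : convex_body Q ->
  is_proj Q x y -> is_proj Q x' y' ->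
  enorm (y - y') <= enorm (x - x').
Proof.
move=> hQ hy hy'; have h1 := is_proj_variational hQ hy (proj1 hy').
have h2 := is_proj_variational hQ hy' (proj1 hy).
rewrite ler_enorm.
have h3 : 0 <= mxdot ((x - x') - (y - y')) ((x - x') - (y - y')) by apply: mxdot_ge0.
have h4 : mxdot (x - y) (y' - y) + mxdot (x' - y') (y - y') =
    mxdot (y - y') (y - y') - mxdot (x - x') (y - y').
  rewrite -[y' - y]opprB mxdotNr -!mxdotNl -!mxdotDl; congr mxdot.
  by apply/rowP => i; rewrite !mxE; ring.
move: h3; rewrite -[y - y' in X in X -> _]scale1r mxdot_subZ !mulr1 mul1r.
by clear -h1 h2 h4; lra.
Qed.

Lemma eprojP Q x : convex_body Q -> is_proj Q x (eproj Q x).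
Proof.
move=> hQ; have [y hy] := is_proj_exists x hQ.
exact: (@getPex _ [set y | Q y /\ forall z, Q z -> enorm (x - y) <= enorm (x - z)]
  (ex_intro _ y hy)).
Qed.

Lemma eproj_unique Q x y : convex_body Q -> is_proj Q x y -> eproj Q x = y.
Proof.
move=> hQ hy; have := is_proj_nonexpansive hQ (eprojP x hQ) hy.
rewrite subrr enorm0 => h; apply/eqP; rewrite -subr_eq0; apply/eqP.
by apply: enorm_eq0; apply/le_anti; rewrite h enorm_ge0.
Qed.

Lemma eproj_nonexpansive Q x x' : convex_body Q ->
  enorm (eproj Q x - eproj Q x') <= enorm (x - x').
Proof. by move=> hQ; apply: is_proj_nonexpansive hQ (eprojP x hQ) (eprojP x' hQ). Qed.

Lemma eproj0 Q : convex_body Q -> eproj Q 0 = 0.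
Proof.
move=> hQ; apply: (eproj_unique hQ); split=> [|z _]; first by case: hQ.
by rewrite subrr enorm0 enorm_ge0.
Qed.

Lemma semialg_fun_eproj Q i : convex_body Q -> semialg_fun (fun x => eproj Q x 0 i).
Proof.
move=> hQ; have Qsa : semialg_set Q by case: hQ.
apply: semialg_funP; apply: (@semialg_iff _ (fun e => exists w : 'rV[R]_p, Q w /\
    ((forall z : 'rV[R]_p, Q z ->
     mxdot (\row_(j < p) e`_j - w) (\row_(j < p) e`_j - w) <=
     mxdot (\row_(j < p) e`_j - z) (\row_(j < p) e`_j - z)) /\ w 0 i = e`_p))).
  move=> e; split=> [[w [Qw [hw <-]]]|<-].
    suff -> : eproj Q (\row_(j < p) e`_j) = w by [].
    by apply: eproj_unique => //; split=> // z Qz; rewrite ler_enorm; apply: hw.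
  have [Qw hw] := eprojP (\row_(j < p) e`_j) hQ.
  exists (eproj Q (\row_(j < p) e`_j)); split=> //; split=> // z Qz.
  by rewrite -ler_enorm; apply: hw.
rewrite /mxdot; semialg_tac.
  by apply: Qsa => k; semialg_tac.
by apply: Qsa => k; semialg_tac.
Qed.

End Projection.

(** * The spectral-norm ball pulled back by the adjoint *)

Section SpectralBall.
Variables (R : realType) (m n p : nat).
Variable Astar : {linear 'rV[R]_p -> 'M[R]_(m, n)}.

Lemma enorm_le_sum k l (M : 'M[R]_(k, l)) : enorm M <= \sum_i \sum_j `|M i j|.
Proof.
set S := \sum_i _.
have S0 : 0 <= S by apply: sumr_ge0 => i _; apply: sumr_ge0.
rewrite -(ger0_norm S0) -sqrtr_sqr ler_wsqrtr // expr2 {1}/S mulr_suml.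
apply: ler_sum => i _; rewrite mulr_suml; apply: ler_sum => j _.
rewrite -expr2 -[M i j ^+ 2]real_normK ?num_real // expr2 ler_wpM2l //.
rewrite /S (bigD1 i) //= (bigD1 j) //= -addrA lerDl addr_ge0 //; first exact: sumr_ge0.
by apply: sumr_ge0 => ? _; apply: sumr_ge0.
Qed.

(** The set under the supremum is nonempty and bounded by the sum of the absolute entries of [X], so
    the bound on [sup] becomes a universally quantified, first-order condition. *)
Lemma spectral_norm_le1 (X : 'M[R]_(m, n)) : spectral_norm X <= 1 <->
  forall v : 'cV[R]_n, enorm v <= 1 -> enorm (X *m v) <= 1.
Proof.
rewrite /spectral_norm; set S := [set _ | _ in _].
have Sub : has_ubound S.
  exists (\sum_(i < m) \sum_(j < 1) \sum_k `|X i k|) => _ [v /= v1 <-].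
  apply: le_trans (enorm_le_sum _) _; apply: ler_sum => i _; apply: ler_sum => j _.
  rewrite mxE; apply: le_trans (ler_norm_sum _ _ _) _; apply: ler_sum => k _.
  by rewrite normrM ler_piMr // (le_trans (le_coord_enorm _ _ _)).
split=> [h v v1|h].
  by apply: le_trans h; apply: (ub_le_sup Sub); exists v.
apply: ge_sup; last by move=> _ [v /= v1 <-]; apply: h.
by exists (enorm (X *m (0 : 'cV[R]_n))), 0 => //=; rewrite enorm0.
Qed.

Lemma linear_delta z : Astar z = \sum_k z 0 k *: Astar (delta_mx 0 k).
Proof. by rewrite {1}[z]row_sum_delta linear_sum; apply: eq_bigr => k _; rewrite linearZ. Qed.

Lemma spectral_ball_convex_body :
  convex_body [set z : 'rV[R]_p | spectral_norm (Astar z) <= 1].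
Proof.
split.
(* Squared norms remove the roots, [w] is a row to match [semialg_allv], and expanding in the
   standard basis exhibits the entries of [Astar (v e)] as linear in the coordinates. *)
- move=> v sv; apply: (@semialg_iff _ (fun e => forall w : 'rV[R]_n,
    \sum_j w 0 j * w 0 j <= 1 ->
    \sum_i (\sum_j (\sum_k v e 0 k * Astar (delta_mx 0 k) i j) * w 0 j) *
           (\sum_j (\sum_k v e 0 k * Astar (delta_mx 0 k) i j) * w 0 j) <= 1)); last first.
    by semialg_tac; exact: (sfun_drop n (sv _)).
  move=> e.
  have le1 k l (M : 'M[R]_(k, l)) : (enorm M <= 1) = (mxdot M M <= 1).
    by rewrite -{1}[1]sqrtr1 ler_sqrt ?ltr01.
  have hn (w : 'rV[R]_n) : mxdot w^T w^T = \sum_j w 0 j * w 0 j.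
    by apply: eq_bigr => j _; rewrite big_ord1 !mxE.
  have hA (w : 'rV[R]_n) : mxdot (Astar (v e) *m w^T) (Astar (v e) *m w^T) =
    \sum_i (\sum_j (\sum_k v e 0 k * Astar (delta_mx 0 k) i j) * w 0 j) *
           (\sum_j (\sum_k v e 0 k * Astar (delta_mx 0 k) i j) * w 0 j).
    apply: eq_bigr => i _; rewrite big_ord1.
    suff -> : (Astar (v e) *m w^T) i 0 =
      \sum_j (\sum_k v e 0 k * Astar (delta_mx 0 k) i j) * w 0 j by [].
    rewrite mxE; apply: eq_bigr => j _; rewrite mxE; congr (_ * _).
    by rewrite linear_delta summxE; apply: eq_bigr => k _; rewrite mxE.
  split=> [h|/spectral_norm_le1 h w].
    apply/spectral_norm_le1 => w; rewrite -[w]trmxK !le1 hn hA; exact: h.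
  by rewrite -hn -hA -!le1; apply: h.
- by apply/spectral_norm_le1 => v _; rewrite linear0 mul0mx enorm0.
- move=> y z t /spectral_norm_le1 hy /spectral_norm_le1 hz /andP[t0 t1].
  apply/spectral_norm_le1 => v v1.
  have -> : y + t *: (z - y) = (1 - t) *: y + t *: z.
    by apply/rowP => i; rewrite !mxE; ring.
  rewrite linearD !linearZ /= mulmxDl -!scalemxAl.
  apply: le_trans (ler_enormD _ _) _; rewrite !enormZ.
  rewrite (ger0_norm t0) ger0_norm ?subr_ge0 //.
  rewrite -[leRHS](subrK t); apply: lerD.
    by rewrite ler_piMr ?subr_ge0 // hy.
  by rewrite ler_piMr // hz.
- move=> x hx; apply/spectral_norm_le1 => v v1; apply/ler_addgt0Pr => c c0.
  (* A Lipschitz constant, for the 1-norm, of the linear map sending [d] to [Astar d *m v]; it makes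
     the constraint pass to limits. *)
  pose K := \sum_k enorm (Astar (delta_mx 0 k) *m v).
  have K0 : 0 <= K by apply: sumr_ge0 => k _; apply: enorm_ge0.
  have hK (d : 'rV[R]_p) : enorm (Astar d *m v) <= K * norm1 d.
    rewrite linear_delta mulmx_suml.
    apply: (@le_trans _ _ (\sum_k enorm ((d 0 k *: Astar (delta_mx 0 k)) *m v))).
      elim/big_rec2: _ => [|k y1 y2 _ h]; first by rewrite enorm0.
      by apply: le_trans (ler_enormD _ _) _; rewrite lerD2l.
    rewrite mulr_suml; apply: ler_sum => k _.
    rewrite -scalemxAl enormZ mulrC ler_wpM2l ?enorm_ge0 //.
    exact: le_coord_norm1.
  have [|z /spectral_norm_le1 hz zx] := hx (c / (K + 1)).
    by rewrite divr_gt0 // ltr_wpDl.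
  have -> : x = z - (z - x) by rewrite opprB addrC subrK.
  rewrite linearB mulmxBl; apply: le_trans (ler_enormD _ _) _.
  rewrite enormN lerD // ?hz //; apply: le_trans (hK _) _.
  apply: (@le_trans _ _ (K * (c / (K + 1)))); first by rewrite ler_wpM2l.
  have K1 : 0 < K + 1 by rewrite ltr_wpDl.
  by rewrite mulrA ler_pdivrMr // mulrDr mulr1 mulrC lerDl ltW.
Qed.

End SpectralBall.

(** * The value function *)

Section ValueFunction.
Variables (R : realType) (p : nat) (Q : set 'rV[R]_p) (b : 'rV[R]_p).
Hypothesis hQ : convex_body Q.

Definition value (l : R) : R := enorm (l *: eproj Q (l^-1 *: b)).

Lemma sfun_sqrt g : sfun g -> sfun (fun e : seq R => Num.sqrt (g e)).
Proof.
move=> /(sfun_drop 1) sg.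
apply: (@semialg_iff _ (fun e => (0 <= g (drop 1 e) ->
    0 <= e`_0 /\ e`_0 * e`_0 = g (drop 1 e)) /\ (g (drop 1 e) <= 0 -> e`_0 = 0))).
  move=> e; split=> [[h1 h2]|<-].
    have [g0|g0] := leP (g (drop 1 e)) 0; first by rewrite ler0_sqrtr // h2.
    by have [e0 <-] := h1 (ltW g0); rewrite -expr2 sqrtr_sqr ger0_norm.
  split=> [g0|g0]; last exact: ler0_sqrtr.
  by split; [exact: sqrtr_ge0|rewrite -expr2 sqr_sqrtr].
by semialg_tac.
Qed.

Lemma sfun1_value : sfun1 value.
Proof.
apply: sfun_sqrt; apply: sfun_sum => i; apply: sfun_sum => j; rewrite ord1.
have h : sfun (fun e => (e`_0 *: eproj Q ((e`_0)^-1 *: b)) 0 j).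
  apply: (sfun_ext (g := fun e => e`_0 * eproj Q ((e`_0)^-1 *: b) 0 j)).
    by move=> e; rewrite [RHS]mxE.
  apply: sfun_mul; first exact: sfun_var.
  by apply: (semialg_fun_eproj j hQ) => k; semialg_tac.
by apply: sfun_mul.
Qed.

(** Split [l y - l' y'] as [(l - l') y + l' (y - y')]. Each part contributes
    [enorm b / l * |l - l'|]: the first because the projection is nonexpansive and fixes 0, the
    second because the factor [l'] cancels in [l' * |1 / l - 1 / l'|]. *)
Lemma value_lip l l' : 0 < l -> 0 < l' ->
  `|value l - value l'| <= 2 * enorm b / l * `|l - l'|.
Proof.
move=> l0 l'0; apply: le_trans (ler_dist_enorm _ _) _.
set y := eproj Q (l^-1 *: b); set y' := eproj Q (l'^-1 *: b).
have -> : l *: y - l' *: y' = (l - l') *: y + l' *: (y - y').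
  by apply/rowP => i; rewrite !mxE; ring.
apply: le_trans (ler_enormD _ _) _; rewrite !enormZ (gtr0_norm l'0).
have hy : enorm y <= enorm b / l.
  have := eproj_nonexpansive (l^-1 *: b) 0 hQ.
  by rewrite eproj0 // !subr0 enormZ gtr0_norm ?invr_gt0 // mulrC.
have hyy : l' * enorm (y - y') <= enorm b / l * `|l - l'|.
  apply: (@le_trans _ _ (l' * enorm (l^-1 *: b - l'^-1 *: b))).
    by rewrite ler_pM2l // eproj_nonexpansive.
  rewrite -scalerBl enormZ (_ : l^-1 - l'^-1 = (l' - l) / (l * l')); last first.
    by field; rewrite !gt_eqF.
  rewrite normrM normfV (gtr0_norm (mulr_gt0 l0 l'0)) (distrC l).
  rewrite (_ : l' * _ = enorm b / l * `|l' - l|) //.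
  by field; rewrite !gt_eqF.
have : `|l - l'| * enorm y <= `|l - l'| * (enorm b / l) by rewrite ler_wpM2l.
rewrite -(mulrA 2); move: hyy; set k := enorm b / l => h1 h2.
by clear -h1 h2; lra.
Qed.

Lemma value_semismooth : exists2 g0, 0 < g0 & forall g, 0 < g <= g0 ->
  semismooth_real_on g value [set l | 0 < l].
Proof.
have [|g0 g00 hg] := @semialg_semismooth R 1 1 (rowfun value).
  move=> i v sv; apply: (sfun_ext (g := fun e => value (v e 0 0))).
    by move=> e; rewrite ord1 mxE eqxx mulr1n.
  exact: sfun1_comp sfun1_value (sv 0).
exists g0 => // g /hg; apply.
  rewrite openE => x /= x0; apply: (near_norm1 x0) => y hy /=.
  have := le_lt_trans (le_coord_norm1 _ 0) hy.
  by rewrite !mxE ltr_norml; lra.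
(* Staying above half of the base point bounds the factor [1 / l] of [value_lip] uniformly. *)
move=> x /= x0; exists (2 * enorm b / (x 0 0 / 2)), [set y : 'rV[R]_1 | x 0 0 / 2 < y 0 0].
have x20 : 0 < x 0 0 / 2 by rewrite divr_gt0.
split.
  apply: (near_norm1 x20) => y hy /=.
  have := le_lt_trans (le_coord_norm1 _ 0) hy.
  by rewrite !mxE ltr_norml; lra.
move=> y z /= hy hz.
have y0 := lt_trans x20 hy; have z0 := lt_trans x20 hz.
have -> : enorm (rowfun value y - rowfun value z) = `|value (y 0 0) - value (z 0 0)|.
  by rewrite enorm_rowE big_ord1 sqrtr_sqr !mxE eqxx !mulr1n.
apply: le_trans (value_lip y0 z0) _.
have := le_coord_enorm (y - z) 0 0; rewrite !mxE => h.
apply: ler_pM h => //; first by rewrite divr_ge0 ?mulr_ge0 ?enorm_ge0 // ltW.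
by rewrite ler_wpM2l ?mulr_ge0 ?enorm_ge0 // lef_pV2 ?posrE // ltW.
Qed.

End ValueFunction.

Theorem proposition10 (R : realType) (m n p : nat)
    (A : {linear 'M[R]_(m, n) -> 'rV[R]_p})
    (Astar : {linear 'rV[R]_p -> 'M[R]_(m, n)})
    (adjA : is_adjoint A Astar)
    (b : 'rV[R]_p)
    (hb : 0 < spectral_norm (Astar b)) :
  let Q := [set z : 'rV[R]_p | spectral_norm (Astar z) <= 1] in
  let phi := fun lambda : R => enorm (lambda *: eproj Q (lambda^-1 *: b)) in
  exists g : R, [/\ 0 < g,
    semismooth_on g (eproj Q) [set: 'rV[R]_p]
    & semismooth_real_on g phi [set lambda : R | 0 < lambda]].
Proof.
move=> Q phi; have hQ : convex_body Q := spectral_ball_convex_body Astar.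
have [g1 g10 h1] := semialg_semismooth (fun i => semialg_fun_eproj i hQ).
have [g2 g20 h2] := value_semismooth b hQ.
have [m1 m2] : Num.min g1 g2 <= g1 /\ Num.min g1 g2 <= g2.
  by rewrite !ge_min !lexx orbT.
have m0 : 0 < Num.min g1 g2 by rewrite lt_min g10.
(* Each conclusion holds for all positive exponents up to its own bound, so the smaller bound serves
   both. *)
exists (Num.min g1 g2); split=> //; last by apply: h2; rewrite m0.
apply: h1; rewrite ?m0 //; first exact: openT.
move=> x _; exists 1, setT; split; first exact: filterT.
by move=> y z _ _; rewrite mul1r; apply: eproj_nonexpansive.
Qed.
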